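(* Let $T>0$. Let $q$ and $u_0$ be distributions on $(0,1)$ with $q\ge0$, let $a$ be a distribution on $[0,T]$, and suppose there exists $a_0>0$ such that $a\ge a_0>0$ in the sense that $\langle a-a_0,\phi\rangle\ge0$ for any test function $\phi\ge0$. Then the initial/boundary value problem $$\begin{cases} i\partial_t u(t,x)+a(t)\left(-\partial_x^2u(t,x)+q(x)u(t,x)\right)=0, & (t,x)\in[0,T]\times(0,1),\\ u(0,x)=u_0(x), & x\in(0,1),\\ u(t,0)=0=u(t,1), & t\in[0,T],\end{cases}$$ has a very weak solution.
   Context: Nets are indexed by $\varepsilon\in(0,1]$. Moderateness. A net $(u_\varepsilon(t,x))$ is uniformly $L^2$-moderate if there exist $N\in\mathbb{N}_0$, $C>0$ with $\|u_\varepsilon(t,\cdot)\|_{L^2}\le C\varepsilon^{-N}$ for all $t\in[0,T]$. A net $(u_{0,\varepsilon}(x))$ is $H^2$-moderate if there exist $N\in\mathbb{N}_0$, $C>0$ with $\|u_{0,\varepsilon}\|_{L^2}\le C\varepsilon^{-N}$ and $\|u_{0,\varepsilon}''\|_{L^2}\le C\varepsilon^{-N}$. A net $(q_\varepsilon(x))$ is $L^\infty$-moderate if there exist $N\in\mathbb{N}_0$, $C>0$ with $\|q_\varepsilon\|_{L^\infty(0,1)}\le C\varepsilon^{-N}$; a net $(a_\varepsilon(t))$ is $L^\infty$-moderate if there exist $N\in\mathbb{N}_0$, $C>0$ with $\|a_\varepsilon\|_{L^\infty[0,T]}\le C\varepsilon^{-N}$. Regularisation. A regularisation of a distribution is a net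 of smooth functions approximating it as $\varepsilon\to0$, for example obtained by convolution with a Friedrichs mollifier $\psi_\varepsilon(x)=\varepsilon^{-1}\psi(x/\varepsilon)$, $\psi\in C_0^\infty(\mathbb{R})$, $\int\psi=1$. Very weak solution. A net $(u_\varepsilon)_{\varepsilon>0}$ is a very weak solution of the initial/boundary value problem $$\begin{cases} i\partial_t u(t,x)+a(t)\left(-\partial_x^2u(t,x)+q(x)u(t,x)\right)=0, & (t,x)\in[0,T]\times(0,1),\\ u(0,x)=u_0(x), & x\in(0,1),\\ u(t,0)=0=u(t,1), & t\in[0,T],\end{cases}$$ if there exist an $L^\infty$-moderate regularisation $q_\varepsilon$ of $q$, an $L^\infty$-moderate regularisation $a_\varepsilon$ of $a$, and an $H^2$-moderate regularisation $u_{0,\varepsilon}$ of $u_0$ such that, for every $\varepsilon$, $$\begin{cases} i\partial_t u_\varepsilon(t,x)+a_\varepsilon(t)\left(-\partial_x^2u_\varepsilon(t,x)+q_\varepsilon(x)u_\varepsilon(t,x)\right)=0, & (t,x)\in[0,T]\times(0,1),\\ u_\varepsilon(0,x)=u_{0,\varepsilon}(x), & x\in(0,1),\\ u_\varepsilon(t,0)=0=u_\varepsilon(t,1), & t\in[0,T],\end{cases}$$ and $(u_\varepsilon)$ and $(\partial_t u_\varepsilon)$ are uniformly $L^2$-moderate. Solutions $u_\varepsilon$ of the regularised problem are taken in $C([0,T];L^2(0,1))$. *)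

(* Defs.v *)
From HB Require Import structures.
From mathcomp Require Import all_boot all_order all_algebra.
From mathcomp Require Import complex.
From mathcomp Require Import all_classical all_reals all_analysis.

Set Implicit Arguments.
Unset Strict Implicit.
Unset Printing Implicit Defensive.

Import Order.TTheory GRing.Theory Num.Theory.
Import numFieldNormedType.Exports.

Local Open Scope classical_set_scope.
Local Open Scope ring_scope.

Section Distributions.
Context {R : realType}.
Local Notation mu := (@lebesgue_measure R).
Implicit Types (X U K : set R) (f g phi psi : R -> R) (L : (R -> R) -> R).

                                                                         
                                                                               
Definition smooth_on X f : Prop :=
  exists U g, [/\ open U, X `<=` U, forall x, X x -> f x = g x &
    forall n x, U x -> derivable (derive1n n g) x 1].

Definition tsupport phi : set R := closure [set x | phi x != 0].

                                                                             
                                      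
Definition test_function X phi : Prop :=
  [/\ smooth_on setT phi, compact (tsupport phi) & tsupport phi `<=` X].

                                                                             
                                                                                 
Definition distribution_on X L : Prop :=
  (forall (c : R) phi psi, test_function X phi -> test_function X psi ->
     L (fun x => c * phi x + psi x) = c * L phi + L psi) /\
  (forall K, compact K -> K `<=` X -> exists (C : R) (N : nat),
     forall phi, test_function X phi -> tsupport phi `<=` K ->
     `|L phi| <= C * \sum_(k < N.+1) sup (range (fun x => `|derive1n k phi x|))).

Definition nonneg_distribution X L : Prop :=
  forall phi, test_function X phi -> (forall x, 0 <= phi x) -> 0 <= L phi.

                                                 
Definition distr_of X f : (R -> R) -> R :=
  fun phi => (\int[mu]_(x in X) (f x * phi x))%R.

                                                                      
Definition regularisation X (fe : R -> R -> R) L : Prop :=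
  (forall eps, 0 < eps <= 1 -> smooth_on X (fe eps)) /\
  (forall phi, test_function X phi ->
     distr_of X (fe eps) phi @[eps --> 0^'+] --> L phi).

Definition Linfty_norm X f : \bar R := Lnorm mu +oo%E (EFin \o (f \_ X)).

Definition Linfty_moderate X (fe : R -> R -> R) : Prop :=
  exists (N : nat) (C : R), 0 < C /\ forall eps, 0 < eps <= 1 ->
    (Linfty_norm X (fe eps) <= (C * eps ^- N)%:E)%E.

End Distributions.

Section ComplexFunctions.
Context {R : realType}.
Local Notation mu := (@lebesgue_measure R).
Local Notation I01 := (`]0, 1[%classic : set R).
Implicit Types (f g w : R -> R[i]) (u v : R -> R -> R[i]).

Definition rpart f : R -> R := fun x => complex.Re (f x).
Definition ipart f : R -> R := fun x => complex.Im (f x).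

Definition cdistribution_on (X : set R) (L : (R -> R) -> R[i]) : Prop :=
  distribution_on X (fun phi => complex.Re (L phi)) /\
  distribution_on X (fun phi => complex.Im (L phi)).

Definition cregularisation (X : set R) (fe : R -> R -> R[i])
    (L : (R -> R) -> R[i]) : Prop :=
  regularisation X (fun eps => rpart (fe eps)) (fun phi => complex.Re (L phi)) /\
  regularisation X (fun eps => ipart (fe eps)) (fun phi => complex.Im (L phi)).

Definition cderive2 f : R -> R[i] :=
  fun x => (derive1n 2 (rpart f) x +i* derive1n 2 (ipart f) x)%C.

                                                       
Definition L2_norm f : \bar R :=
  Lnorm mu 2%:E (EFin \o ((fun x => ComplexField.Normc.normc (f x)) \_ I01)).

Definition in_L2 f : Prop :=
  [/\ measurable_fun I01 (rpart f), measurable_fun I01 (ipart f) &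
      (L2_norm f < +oo)%E].

Definition H2_moderate (fe : R -> R -> R[i]) : Prop :=
  exists (N : nat) (C : R), 0 < C /\ forall eps, 0 < eps <= 1 ->
    (L2_norm (fe eps) <= (C * eps ^- N)%:E)%E /\
    (L2_norm (cderive2 (fe eps)) <= (C * eps ^- N)%:E)%E.

Definition unif_L2_moderate (T : R) (ue : R -> R -> R -> R[i]) : Prop :=
  exists (N : nat) (C : R), 0 < C /\ forall eps, 0 < eps <= 1 ->
    forall t, 0 <= t <= T -> (L2_norm (ue eps t) <= (C * eps ^- N)%:E)%E.

                                     
Definition continuous_L2 (T : R) u : Prop :=
  forall t, 0 <= t <= T -> in_L2 (u t) /\
    L2_norm (fun x => u s x - u t x) @[s --> within `[0, T] (nbhs t)] --> 0%E.

                                                                              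
                 
Definition time_derivative_L2 (T : R) u v : Prop :=
  forall t, 0 <= t <= T -> in_L2 (v t) /\
    L2_norm (fun x => ((s - t)^-1)%:C%C * (u s x - u t x) - v t x)
      @[s --> within `[0, T] t^'] --> 0%E.

                                                                            
Definition weak_derivative2 f w : Prop :=
  forall phi, test_function I01 phi ->
    distr_of I01 (rpart f) (derive1n 2 phi) = distr_of I01 (rpart w) phi /\
    distr_of I01 (ipart f) (derive1n 2 phi) = distr_of I01 (ipart w) phi.

                                                                     
                                                                      
                                                                           
                                                                            
                                                
Definition schrodinger_solution (T : R) (a q : R -> R) (u0 : R -> R[i]) u ut
    : Prop :=
  [/\ continuous_L2 T u,
      time_derivative_L2 T u ut,
      forall t, 0 <= t <= T -> exists uxx : R -> R[i],
        [/\ in_L2 uxx, weak_derivative2 (u t) uxx &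
            {ae mu, forall x, I01 x ->
              ('i)%C * ut t x
                + (a t)%:C%C * (- uxx x + (q x)%:C%C * u t x) = 0}],
      forall x, 0 < x < 1 -> u 0 x = u0 x &
      forall t, 0 <= t <= T ->
        [/\ {within `[0, 1], continuous (rpart (u t))},
            {within `[0, 1], continuous (ipart (u t))},
            u t 0 = 0 & u t 1 = 0]].

Definition very_weak_solution (T : R) (a q : (R -> R) -> R)
    (u0 : (R -> R) -> R[i]) (u : R -> R -> R -> R[i]) : Prop :=
  exists (qe ae : R -> R -> R) (u0e : R -> R -> R[i]) (ut : R -> R -> R -> R[i]),
    [/\ regularisation I01 qe q /\ Linfty_moderate I01 qe,
        regularisation `[0, T] ae a /\ Linfty_moderate `[0, T] ae,
        cregularisation I01 u0e u0 /\ H2_moderate u0e,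
        forall eps, 0 < eps <= 1 ->
          schrodinger_solution T (ae eps) (qe eps) (u0e eps) (u eps) (ut eps) &
        unif_L2_moderate T u /\ unif_L2_moderate T ut].

End ComplexFunctions.

(* Main.v *)
Require Import Defs.
From HB Require Import structures.
From mathcomp Require Import all_boot all_order all_algebra.
From mathcomp Require Import complex ring lra.
From mathcomp Require Import all_classical all_reals all_analysis.
From mathcomp Require Import measurable_realfun ess_sup_inf.
Import Order.TTheory GRing.Theory Num.Theory.
Import numFieldNormedType.Exports.
Local Open Scope classical_set_scope.
Local Open Scope ring_scope.
Set Implicit Arguments.
Unset Strict Implicit.
Unset Printing Implicit Defensive.

(** Moderateness only asks for a bound by some power of [1 / eps], and the choice
    of the regularisations belongs to the notion of very weak solution. It is
    therefore enough to find a sequence of regularisations, indexed by [n], for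
    which the regularised problem has a solution with finite norms: whatever the
    growth of these norms in [n], running through the sequence slowly as [eps]
    tends to 0 makes them at most [C / eps] ([slow_reindexing]).

    The regularisations are trigonometric sums. A distribution on an interval is
    a weak limit of finite combinations of Dirac masses
    ([distribution_dirac_cvg]): a test function [phi] is the limit, with all its
    derivatives, of Riemann sums of its convolution with a mollifier, and a
    distribution may be applied to such a finite sum term by term. A Dirac mass
    is in turn approximated by normalised powers of a cosine sum that has a
    strict maximum at one point ([concentrated_dirac]). This gives cosine sums
    for [q] and [a], and, with the weight [sin (pi x)], sine sums for [u0]
    ([distribution_trig_cvg]).

    It remains to solve the problem when [q] is a cosine sum, [u0] a sine sum and
    [a] smooth. The operator [H u = - u'' + q u] does not depend on time, so that
    the solution is [exp (i A(t) H) u0], where [A' = a] and [A(0) = 0]. The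
    function [exp (i s H) u0] is the sum of its Dyson series in powers of [q],
    taken around the free evolution [exp (- i s d^2/dx^2)]. The product of
    [sin (j pi x)] and [cos (k pi x)] being a sum of two sines of the same kind,
    each term of the series is a finite sine sum; the coefficients of the term of
    order [m] are bounded by [c^m |s|^m / m!] while its frequencies grow linearly
    with [m], and the series converges with as many derivatives as needed
    ([schrodinger_group], [regular_solution]).

    Integrals are handled through antiderivatives on the whole line: estimates
    of integrals become comparisons of increments ([normr_increment_der]). *)

(** * Derivatives, increments and antiderivatives *)

Section DerivativeRules.
Context {R : realType}.
Implicit Types (f g : R -> R) (x a b c : R).

Lemma der_cst c x : is_derive x 1 (fun _ : R => c) 0.
Proof. exact: is_derive_cst. Qed.

Lemma der_id x : is_derive x 1 (fun y : R => y) 1.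
Proof. exact: is_derive_id. Qed.

Lemma derD f g x a b : is_derive x 1 f a -> is_derive x 1 g b ->
  is_derive x 1 (fun y => f y + g y) (a + b).
Proof. move=> fa gb; exact: is_deriveD. Qed.

Lemma derB f g x a b : is_derive x 1 f a -> is_derive x 1 g b ->
  is_derive x 1 (fun y => f y - g y) (a - b).
Proof. move=> fa gb; exact: is_deriveB. Qed.

Lemma derN f x a : is_derive x 1 f a -> is_derive x 1 (fun y => - f y) (- a).
Proof. move=> fa; exact: is_deriveN. Qed.

Lemma derM f g x a b : is_derive x 1 f a -> is_derive x 1 g b ->
  is_derive x 1 (fun y => f y * g y) (a * g x + f x * b).
Proof.
by move=> fa gb; apply: is_derive_eq; rewrite /GRing.scale/= addrC mulrC.
Qed.

Lemma derZ c f x a : is_derive x 1 f a ->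
  is_derive x 1 (fun y => c * f y) (c * a).
Proof.
by move=> fa; apply: is_derive_eq (derM (der_cst c x) fa) _; rewrite mul0r add0r.
Qed.

Lemma derX f x a n : is_derive x 1 f a ->
  is_derive x 1 (fun y => f y ^+ n.+1) (n.+1%:R * f x ^+ n * a).
Proof.
move=> fa; elim: n => [|n IH].
  by under eq_fun do rewrite expr1; rewrite expr0 !mul1r.
under eq_fun do rewrite exprS.
by apply: is_derive_eq (derM fa IH) _; rewrite -!natr1 !exprS; ring.
Qed.

Lemma der_comp f g x a b : is_derive (g x) 1 f a -> is_derive x 1 g b ->
  is_derive x 1 (fun y => f (g y)) (a * b).
Proof. move=> fa gb; exact: is_derive1_comp. Qed.

Lemma der_affine f x a (c d : R) : is_derive (c * x + d) 1 f a ->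
  is_derive x 1 (fun y => f (c * y + d)) (c * a).
Proof.
move=> fa; rewrite mulrC; apply: (@der_comp f (fun y => c * y + d)) => //.
apply: is_derive_eq (derD (derZ c (der_id x)) (der_cst d x)) _.
by rewrite mulr1 addr0.
Qed.

Lemma der_scaled f x a c : is_derive (c * x) 1 f a ->
  is_derive x 1 (fun y => f (c * y)) (c * a).
Proof.
move=> fa; have := @der_affine f x a c 0; rewrite addr0 => /(_ fa).
by under eq_fun do rewrite addr0.
Qed.

Lemma der_sum (I : finType) (f : I -> R -> R) x (a : I -> R) :
  (forall i, is_derive x 1 (f i) (a i)) ->
  is_derive x 1 (fun y => \sum_i f i y) (\sum_i a i).
Proof.
move=> fa; rewrite -fct_sumE.
by elim/big_ind2 : _ => // [|? ? ? ? *]; [exact: is_derive_cst|exact: is_deriveD].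
Qed.

Lemma der_continuous f x a : is_derive x 1 f a -> {for x, continuous f}.
Proof. by case=> + _ => /derivable1_diffP/differentiable_continuous. Qed.

Lemma der_derive1 f x a : is_derive x 1 f a -> derive1 f x = a.
Proof. by move=> fa; rewrite derive1E derive_val. Qed.

Lemma derivable_der f x : derivable f x 1 -> is_derive x 1 f (derive1 f x).
Proof. by move=> fx; apply: DeriveDef => //; rewrite derive1E. Qed.

Lemma der_cos_scaled (l s : R) :
  is_derive s 1 (fun s => cos (l * s)) (- (l * sin (l * s))).
Proof.
by apply: is_derive_eq (der_scaled (is_derive_cos (l * s))) _; rewrite mulrN.
Qed.

Lemma der_sin_scaled (l s : R) :
  is_derive s 1 (fun s => sin (l * s)) (l * cos (l * s)).
Proof. exact: der_scaled (is_derive_sin (l * s)). Qed.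

End DerivativeRules.

Section MeanValue.
Context {R : realType}.
Implicit Types (F K f k : R -> R) (a b c x y : R).

(** This comparison of increments takes the place of the monotonicity of the
    integral. *)
Lemma ler_increment_der F K f k a b : a <= b ->
  (forall x, a <= x <= b -> is_derive x 1 F (f x)) ->
  (forall x, a <= x <= b -> is_derive x 1 K (k x)) ->
  (forall x, a <= x <= b -> f x <= k x) -> F b - F a <= K b - K a.
Proof.
move=> ab Ff Kk fk; rewrite -subr_ge0.
have D x : a <= x <= b -> is_derive x 1 (fun y => K y - F y) (k x - f x).
  by move=> xab; apply: derB; [exact: Kk|exact: Ff].
have : (K a - F a) <= K b - F b.
  apply: (@ger0_derive1_ndecr _ (fun y => K y - F y) a b) => //.
  - by move=> x; rewrite in_itv/= => /andP[/ltW ? /ltW ?];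
      have [] := D x _; rewrite ?andbT; first exact/andP.
  - move=> x; rewrite in_itv/= => /andP[/ltW ? /ltW ?].
    have xab : a <= x <= b by apply/andP.
    by rewrite (der_derive1 (D x xab)) subr_ge0 fk.
  - apply: continuous_in_subspaceT => x; rewrite inE/= in_itv/= => xab.
    exact: der_continuous (D x xab).
by lra.
Qed.

Lemma normr_increment_der F K f k a b : a <= b ->
  (forall x, a <= x <= b -> is_derive x 1 F (f x)) ->
  (forall x, a <= x <= b -> is_derive x 1 K (k x)) ->
  (forall x, a <= x <= b -> `|f x| <= k x) -> `|F b - F a| <= K b - K a.
Proof.
move=> ab Ff Kk fk; rewrite ler_norml; apply/andP; split.
  have : (- F b) - (- F a) <= K b - K a; last by lra.
  apply: (@ler_increment_der (fun x => - F x) K (fun x => - f x) k) => // x xab.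
    exact: derN (Ff x xab).
  by have := fk x xab; rewrite ler_norml => /andP[]; rewrite lerNl.
apply: (@ler_increment_der F K f k a b) => // x xab.
exact: le_trans (ler_norm _) (fk x xab).
Qed.

Lemma normr_lipschitz F f c a b :
  (forall x, (a <= x <= b) || (b <= x <= a) -> is_derive x 1 F (f x)) ->
  (forall x, (a <= x <= b) || (b <= x <= a) -> `|f x| <= c) ->
  `|F b - F a| <= c * `|b - a|.
Proof.
wlog ab : a b / a <= b.
  move=> W Ff fc; case: (leP a b) => [ab|/ltW ba]; first exact: W.
  rewrite distrC (distrC b); apply: W => // x xab; [apply: Ff|apply: fc];
    by rewrite orbC.
move=> Ff fc; rewrite (ger0_norm (_ : 0 <= b - a)) ?subr_ge0// mulrBr.
apply: (@normr_increment_der F (fun x => c * x) f (fun=> c)) => // x xab.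
- by apply: Ff; rewrite xab.
- by apply: is_derive_eq (derZ c (der_id x)) _; rewrite mulr1.
- by apply: fc; rewrite xab.
Qed.

(** The remainder [F y - F x - (y - x) F' x] is itself a function of [y] whose
    derivative is at most [c |y - x|]. *)
Lemma normr_taylor2 F f g c x y :
  (forall z, (x <= z <= y) || (y <= z <= x) -> is_derive z 1 F (f z)) ->
  (forall z, (x <= z <= y) || (y <= z <= x) -> is_derive z 1 f (g z)) ->
  (forall z, (x <= z <= y) || (y <= z <= x) -> `|g z| <= c) ->
  `|F y - F x - (y - x) * f x| <= c * (y - x) ^+ 2.
Proof.
move=> Ff fg gc.
have xx : (x <= x <= y) || (y <= x <= x).
  by rewrite lexx/= andbT; case: (leP x y) => // /ltW.
have c0 : 0 <= c by apply: le_trans (gc x xx); rewrite normr_ge0.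
pose G z := F z - z * f x.
have -> : F y - F x - (y - x) * f x = G y - G x by rewrite /G; ring.
rewrite -real_normK ?num_real// expr2 mulrA.
apply: (@normr_lipschitz G (fun z => f z - f x)) => z zxy.
  apply: derB; first exact: Ff.
  by apply: is_derive_eq (derM (der_id z) (der_cst (f x) z)) _; rewrite mul1r mulr0 addr0.
have zin w : (x <= w <= z) || (z <= w <= x) -> (x <= w <= y) || (y <= w <= x).
  by move: zxy; lra.
apply: (@le_trans _ _ (c * `|z - x|)).
  by apply: (@normr_lipschitz f g) => w wz; [apply: fg|apply: gc]; exact: zin.
rewrite ler_wpM2l// !ler_norml.
by move: zxy; case/orP=> zxy; case: (ger0P (y - x)); lra.
Qed.

(** A quadratic bound on the remainder identifies the derivative: this is how
    the sum of a series of functions is differentiated below. *)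
Lemma der_of_quadratic F a c x : (forall y, `|y - x| <= 1 ->
    `|F y - F x - (y - x) * a| <= c * (y - x) ^+ 2) ->
  is_derive x 1 F a.
Proof.
move=> Fa.
have c0 : 0 <= c.
  have /= := Fa (x + 1); rewrite addrAC subrr add0r normr1 => /(_ (lexx _)).
  by rewrite expr1n mulr1; apply: le_trans.
have L : h^-1 *: ((F \o shift x) (h *: 1) - F x) @[h --> 0^'] --> a.
  apply/cvgrPdist_le => e e0; near=> h.
  have h0 : h != 0 by near: h; exact: nbhs_dnbhs_neq.
  have hd : `|h| <= Num.min 1 (e / (c + 1)).
    near: h; apply: dnbhs0_le; rewrite lt_min ltr01/= divr_gt0//.
    by rewrite ltr_wpDl.
  move: hd; rewrite le_min => /andP[h1 he].
  have := Fa (x + h); rewrite (addrC x) addrK => /(_ h1) H.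
  rewrite /= /GRing.scale/= mulr1 distrC.
  have -> : h^-1 * (F (h + x) - F x) - a = h^-1 * (F (h + x) - F x - h * a).
    by field.
  rewrite normrM normfV ler_pdivrMl ?normr_gt0//.
  apply: (le_trans H); rewrite -real_normK ?num_real// expr2 mulrA [leRHS]mulrC.
  apply: ler_wpM2r => //.
  apply: (@le_trans _ _ (c * (e / (c + 1)))); first by rewrite ler_wpM2l.
  rewrite mulrCA ler_piMr ?(ltW e0)// ler_pdivrMr ?mul1r ?ler_wpDr ?ltr_wpDl//; lra.
apply: DeriveDef; first by apply/cvg_ex; exists a.
exact/cvg_lim.
Unshelve. all: by end_near. Qed.

End MeanValue.

Section Antiderivative.
Context {R : realType}.
Local Notation mu := (@lebesgue_measure R).
Implicit Types (f : R -> R).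

Lemma continuous_integrable_itv f (a b : R) : continuous f ->
  mu.-integrable `[a, b] (EFin \o f).
Proof.
move=> cf; apply: continuous_compact_integrable; first exact: segment_compact.
exact: continuous_subspaceT.
Qed.

(** Subtracting the integral over [[x, 0]] from the one over [[0, x]], one of
    which is zero, gives a single formula for both signs of [x]. *)
Lemma antiderivative_exists f : continuous f ->
  exists F : R -> R, F 0 = 0 /\ forall x : R, is_derive x 1 F (f x).
Proof.
move=> cf.
pose F x := \int[mu]_(t in `[0, x]) f t - \int[mu]_(t in `[x, 0]) f t.
exists F; split; first by rewrite /F subrr.
move=> x.
pose B : R := `|x| + 1.
have xB : - B < x < B.
  by rewrite -ltr_norml /B ltrDl.
pose G y := \int[mu]_(t in `[- B, y]) f t.
have Gx : is_derive x 1 G (f x).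
  case/andP: xB => Bx xB.
  have [dG G'] := @continuous_FTC1_closed _ f (- B) x B xB
    (continuous_integrable_itv _ _ cf) Bx (cf x).
  exact: is_derive_eq (derivable_der dG) G'.
have B0 : - B < 0 by rewrite oppr_lt0 ltr_wpDl.
have FG : \forall y \near x, F y = G y - G 0.
  have : \forall y \near x, y \in `]- B, B[ .
    by apply: near_in_itvoo; rewrite in_itv/=.
  apply: filterS => y; rewrite in_itv/= => /andP[By yB].
  have spl u v : - B <= u -> u <= v ->
      G v - G u = \int[mu]_(t in `[u, v]) f t.
    move=> Bu uv.
    rewrite Rintegral_itvB ?bnd_simp//; last exact: continuous_integrable_itv.
    apply: Rintegral_itv_obnd_cbnd.
    apply: (integrableS _ _ _ (continuous_integrable_itv u v cf)) => //.
    by apply: subset_itvr; rewrite bnd_simp.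
  have emp u v : v < u -> \int[mu]_(t in `[u, v]) f t = 0.
    by move=> vu; rewrite set_itv_ge ?Rintegral_set0// bnd_simp -ltNge.
  case: (ltgtP 0 y) => [y0|y0|<-].
  - by rewrite spl ?ltW// /F (emp y 0)// subr0.
  - by rewrite -opprB spl ?ltW// /F (emp 0 y)// sub0r.
  - by rewrite /F !subrr.
apply: (@near_eq_is_derive _ _ _ (fun y => G y - G 0) _ x 1 (f x)) => //.
  by apply: filterS FG => y ->.
by apply: is_derive_eq (derB Gx (der_cst (G 0) x)) _; rewrite subr0.
Qed.

End Antiderivative.

Section Primitive.
Context {R : realType}.

Definition primitive (f : R -> R) : R -> R := xget (fun=> 0)
  [set F : R -> R | F 0 = 0 /\ forall x : R, is_derive x 1 F (f x)].

Lemma primitiveP (f : R -> R) : continuous f ->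
  primitive f 0 = 0 /\ forall x : R, is_derive x 1 (primitive f) (f x).
Proof.
move=> cf; rewrite /primitive; case: xgetP => // noF.
by have [F Ff] := antiderivative_exists cf; case: (noF F).
Qed.

(** The origin of the factorials in the Dyson series. *)
Lemma normr_primitive_le (f : R -> R) (C : R) m s : continuous f ->
  (forall x, `|f x| <= C * (`|x| ^+ m / m`!%:R)) ->
  `|primitive f s| <= C * (`|s| ^+ m.+1 / m.+1`!%:R).
Proof.
move=> cf fC; have [F0 Ff] := primitiveP cf.
have K (x : R) : is_derive x 1 (fun y : R => C * (y ^+ m.+1 / m.+1`!%:R))
    (C * (x ^+ m / m`!%:R)).
  apply: is_derive_eq (derZ C (derM (derX m (der_id x)) (der_cst _ x))) _.
  rewrite mulr0 addr0 mulr1 factS natrM -mulr_natl.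
  have : (m`!%:R : R) != 0 by rewrite pnatr_eq0 -lt0n fact_gt0.
  have : (m.+1%:R : R) != 0 by rewrite pnatr_eq0.
  by move=> ? ?; congr (_ * _); field; apply/andP.
have z : C * (0 ^+ m.+1 / m.+1`!%:R) = 0 by rewrite expr0n/= mul0r mulr0.
case: (leP 0 s) => s0.
  rewrite (ger0_norm s0) -[primitive f s]subr0 -F0 -[leRHS]subr0 -{2}z.
  apply: (normr_increment_der s0 (fun x _ => Ff x) (fun x _ => K x)).
  by move=> x /andP[x0 _]; rewrite -{2}(ger0_norm x0) fC.
rewrite (ltr0_norm s0) -[primitive f s]subr0 -F0 -[leRHS]subr0 -{2}z.
rewrite -{1}[s]opprK -{1}oppr0.
have s0' : 0 <= - s by rewrite oppr_ge0 ltW.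
apply: (@normr_increment_der _ (fun x => primitive f (- x)) _ (fun x => - f (- x))
  _ _ _ s0' _ (fun x _ => K x)).
  move=> x _; apply: is_derive_eq (der_comp (Ff (- x)) (derN (der_id x))) _.
  by rewrite mulrN1.
by move=> x /andP[x0 _]; rewrite normrN -{2}(ger0_norm x0) -(normrN x) fC.
Qed.

End Primitive.

(** * Smooth functions and test functions *)

Section Smooth.
Context {R : realType}.
Implicit Types (f g : R -> R).

Definition smooth f : Prop := forall n (x : R), derivable (derive1n n f) x 1.

(** Coinduction principle: all derivatives exist in a class of differentiable
    functions that is stable under differentiation. *)
Lemma smooth_of_class (P : (R -> R) -> Prop) f :
    (forall g, P g -> (forall x : R, derivable g x 1) /\ P (derive1 g)) ->
  P f -> smooth f.
Proof.
move=> PD Pf n; have : P (derive1n n f).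
  by elim: n => // n IH; rewrite derive1nS; have [] := PD _ IH.
by move=> /PD[].
Qed.

Lemma derive1nSr f n : derive1n n (derive1 f) = derive1n n.+1 f.
Proof. by rewrite /derive1n -iterSr. Qed.

Lemma smooth_derive1 f : smooth f -> smooth (derive1 f).
Proof. by move=> sf n; rewrite derive1nSr; exact: (sf n.+1). Qed.

Lemma smooth_der f : smooth f ->
  forall n (x : R), is_derive x 1 (derive1n n f) (derive1n n.+1 f x).
Proof. by move=> sf n x; rewrite derive1nS; apply: derivable_der; exact: sf. Qed.

Lemma smooth_continuous f n : smooth f -> continuous (derive1n n f).
Proof. by move=> sf x; exact: der_continuous (smooth_der sf n x). Qed.

Lemma derive1n_lin f g c n : smooth f -> smooth g ->
  derive1n n (fun x => c * f x + g x) =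
  (fun x => c * derive1n n f x + derive1n n g x).
Proof.
move=> sf sg; elim: n => // n IH; rewrite derive1nS IH; apply/funext => x.
apply: der_derive1; apply: derD; last exact: smooth_der.
by apply: derZ; exact: smooth_der.
Qed.

Lemma smooth_lin f g c : smooth f -> smooth g -> smooth (fun x => c * f x + g x).
Proof.
move=> sf sg n x; rewrite derive1n_lin//.
have [] // := derD (derZ c (smooth_der sf n x)) (smooth_der sg n x).
Qed.

Lemma smooth_cst c : smooth (fun _ : R => c).
Proof.
apply: (@smooth_of_class (fun g => exists c, g = fun=> c)); last by exists c.
move=> g [d ->]; split; first by move=> x; exact: derivable_cst.
by exists 0; apply/funext => x; apply: der_derive1; exact: der_cst.
Qed.

Lemma smoothZ f c : smooth f -> smooth (fun x => c * f x).
Proof.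
move=> sf; have := @smooth_lin f (fun=> 0) c sf (@smooth_cst 0).
by under eq_fun do rewrite addr0.
Qed.

Lemma derive1nZ f c n : smooth f ->
  derive1n n (fun x => c * f x) = (fun x => c * derive1n n f x).
Proof.
move=> sf; elim: n => // n IH; rewrite derive1nS IH; apply/funext => x.
by apply: der_derive1; apply: derZ; exact: smooth_der.
Qed.

Lemma smooth_sum n (f : 'I_n -> R -> R) (c : 'I_n -> R) :
  (forall i, smooth (f i)) -> smooth (fun x => \sum_i c i * f i x).
Proof.
elim: n f c => [|n IH] f c sf.
  by under eq_fun do rewrite big_ord0; exact: smooth_cst.
under eq_fun do rewrite big_ord_recl.
by apply: smooth_lin => //; apply: IH.
Qed.

Lemma derive1n_sum n (f : 'I_n -> R -> R) (c : 'I_n -> R) j :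
  (forall i, smooth (f i)) ->
  derive1n j (fun x => \sum_i c i * f i x) =
  (fun x => \sum_i c i * derive1n j (f i) x).
Proof.
elim: n f c => [|n IH] f c sf.
  under eq_fun do rewrite big_ord0; under [RHS]eq_fun do rewrite big_ord0.
  elim: j => // j IHj; rewrite derive1nS IHj; apply/funext => x.
  by apply: der_derive1; exact: der_cst.
under eq_fun do rewrite big_ord_recl.
rewrite derive1n_lin//; last by apply: smooth_sum.
by rewrite IH//; apply/funext => x; rewrite [RHS]big_ord_recl.
Qed.

Lemma smoothM f g : smooth f -> smooth g -> smooth (fun x => f x * g x).
Proof.
move=> sf sg.
(* sums of products of smooth functions are stable under differentiation *)
apply: (@smooth_of_class (fun h => exists (I : finType) (u v : I -> R -> R),
  [/\ forall i, smooth (u i), forall i, smooth (v i) &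
      h = fun x => \sum_i u i x * v i x])); last first.
  exists unit, (fun=> f), (fun=> g); split => //.
  by apply/funext => x; rewrite big_const card_unit/= addr0.
move=> h [I [u [v [su sv ->]]]].
have D (x : R) : is_derive x 1 (fun x => \sum_i u i x * v i x)
    (\sum_i (derive1 (u i) x * v i x + u i x * derive1 (v i) x)).
  by apply: der_sum => i; apply: derM; [exact: (smooth_der (su i) 0)|
    exact: (smooth_der (sv i) 0)].
split; first by move=> x; have [] := D x.
exists (I * bool)%type, (fun p => if p.2 then derive1 (u p.1) else u p.1),
  (fun p => if p.2 then v p.1 else derive1 (v p.1)); split.
- by move=> [i []]; [exact: smooth_derive1 (su i)|exact: su i].
- by move=> [i []]; [exact: sv i|exact: smooth_derive1 (sv i)].
apply/funext => x; rewrite (der_derive1 (D x)).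
rewrite -(pair_bigA _ (fun i (e : bool) =>
  (if e then derive1 (u i) else u i) x * (if e then v i else derive1 (v i)) x))/=.
by apply: eq_bigr => i _; rewrite big_bool.
Qed.

Lemma derive1n_affine f (c d : R) n : smooth f ->
  derive1n n (fun x => f (c * x + d)) =
  (fun x => c ^+ n * derive1n n f (c * x + d)).
Proof.
move=> sf; elim: n => [|n IH].
  by apply/funext => x; rewrite expr0 mul1r.
rewrite derive1nS IH; apply/funext => x; apply: der_derive1.
apply: is_derive_eq (derZ _ (der_affine (smooth_der sf n (c * x + d)))) _.
by rewrite exprSr mulrA.
Qed.

Lemma smooth_affine f (c d : R) : smooth f -> smooth (fun x => f (c * x + d)).
Proof.
move=> sf n x; rewrite derive1n_affine//.
by have [] := derZ (c ^+ n) (der_affine (smooth_der sf n (c * x + d))).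
Qed.

Lemma smooth_trig (c d w : R) :
  smooth (fun x => c * sin (w * x) + d * cos (w * x)).
Proof.
apply: (@smooth_of_class (fun h => exists c d, h =
  fun x => c * sin (w * x) + d * cos (w * x))); last by exists c, d.
move=> h [c' [d' ->]].
have D (x : R) : is_derive x 1 (fun x => c' * sin (w * x) + d' * cos (w * x))
    (c' * (w * cos (w * x)) + d' * - (w * sin (w * x))).
  exact: derD (derZ c' (der_sin_scaled w x)) (derZ d' (der_cos_scaled w x)).
split; first by move=> x; have [] := D x.
exists (- (d' * w)), (c' * w); apply/funext => x; rewrite (der_derive1 (D x)).
by ring.
Qed.

Lemma smooth_sin (w : R) : smooth (fun x => sin (w * x)).
Proof.
have := @smooth_trig 1 0 w.
by under eq_fun do rewrite mul1r mul0r addr0.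
Qed.

Lemma smooth_cos (w : R) : smooth (fun x => cos (w * x)).
Proof.
have := @smooth_trig 0 1 w.
by under eq_fun do rewrite mul0r mul1r add0r.
Qed.

End Smooth.

Section CompactSupport.
Context {R : realType}.
Implicit Types (f g : R -> R) (a b : R).

(** A support condition that, unlike the one on [tsupport], passes to sums and to
    derivatives without closures. *)
Definition vanishes_off a b f := forall x, ~~ (a <= x <= b) -> f x = 0.

Lemma vanishes_off_derive1 a b f : vanishes_off a b f ->
  vanishes_off a b (derive1 f).
Proof.
move=> f0 x xab; apply: der_derive1.
apply: (@near_eq_is_derive _ _ _ (fun=> 0) f x 1 0).
have : nbhs x (~` `[a, b]%classic).
  apply: open_nbhs_nbhs; split; first by apply: closed_openC; exact: itv_closed.
  by rewrite /= in_itv/=; exact/negP.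
apply: filterS.
by move=> y; rewrite /= in_itv/= => /negP yab; rewrite f0.
Qed.

Lemma vanishes_off_derive1n a b f n : vanishes_off a b f ->
  vanishes_off a b (derive1n n f).
Proof.
by move=> f0; elim: n => // n IH; rewrite derive1nS; exact: vanishes_off_derive1.
Qed.

Lemma continuous_bounded_itv a b f : continuous f ->
  exists2 M, 0 <= M & forall x, a <= x <= b -> `|f x| <= M.
Proof.
move=> cf; case: (leP a b) => [ab|ba]; last first.
  by exists 0 => // x /andP[ax xb]; have := le_lt_trans (le_trans ax xb) ba;
    rewrite ltxx.
have [c _ cmax] : exists2 c, c \in `[a, b] &
    forall x, x \in `[a, b] -> `|f x| <= `|f c|.
  apply: (@EVT_max _ (fun x => `|f x|)) => //.
  by apply: continuous_subspaceT => x; apply: cvg_norm; exact: cf.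
by exists `|f c| => // x xab; apply: cmax; rewrite in_itv.
Qed.

Lemma smooth_vanishing_bounded a b f n : smooth f -> vanishes_off a b f ->
  exists2 B, 0 <= B & forall x, `|derive1n n f x| <= B.
Proof.
move=> sf f0.
have [M M0 fM] := continuous_bounded_itv a b (smooth_continuous (n := n) sf).
exists M => // x; case: (boolP (a <= x <= b)) => [|xab]; first exact: fM.
by rewrite (vanishes_off_derive1n n f0)// normr0.
Qed.

(** By continuity; the bound on the derivative makes it quantitative: the value at
    an end point differs by at most [B e] from a value at distance [e]. *)
Lemma smooth_vanishing_ends (a b : R) (f : R -> R) :
  smooth f -> vanishes_off a b f -> f a = 0 /\ f b = 0.
Proof.
move=> sf f0; have [B B0 fB] := smooth_vanishing_bounded 1 sf f0.
have small c : (forall e, 0 < e -> exists2 y, `|c - y| <= e & f y = 0) -> f c = 0.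
  move=> H; apply/eqP; rewrite -normr_le0; apply/ler_addgt0Pl => e e0.
  have [y cy fy] := H (e / (B + 1)) (divr_gt0 e0 (ltr_wpDl B0 ltr01)).
  rewrite addr0 -[f c]subr0 -fy; apply: (@le_trans _ _ (B * `|c - y|)).
    by apply: (@normr_lipschitz _ f (derive1n 1 f)) => z _;
      [exact: (smooth_der sf 0)|exact: fB].
  apply: (le_trans (ler_wpM2l B0 cy)).
  rewrite mulrCA ler_piMr ?(ltW e0)// ler_pdivrMr ?ltr_wpDl//.
  by rewrite mul1r lerDl.
split; apply: small => e e0.
  exists (a - e); first by rewrite opprB addrC subrK ger0_norm// ltW.
  by apply: f0; rewrite negb_and; apply/orP; left; rewrite -ltNge; lra.
exists (b + e); first by rewrite opprD addrA subrr sub0r normrN ger0_norm// ltW.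
by apply: f0; rewrite negb_and; apply/orP; right; rewrite -ltNge; lra.
Qed.

Lemma test_functionE (X : set R) f : test_function X f <->
  [/\ smooth f, compact (tsupport f) & tsupport f `<=` X].
Proof.
split; case=> sf cf fX; split => //.
  case: sf => U [g [_ XU fg sg]] n x.
  have -> : f = g by apply/funext => y; exact: fg.
  by apply: sg; exact: XU.
exists setT, f; split => //; exact: openT.
Qed.

Lemma tsupport_sub a b f : vanishes_off a b f -> tsupport f `<=` `[a, b].
Proof.
move=> f0; rewrite (closure_id `[a, b]%classic).1; last exact: itv_closed.
apply: closureS => x /= fx; rewrite in_itv/=; apply: contraNT fx => xab.
by rewrite f0.
Qed.

Lemma test_function_vanishes (X : set R) a b f : X `<=` `[a, b] ->
  test_function X f -> vanishes_off a b f.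
Proof.
move=> Xab [_ _ fX] x xab; apply: contrapT => /eqP fx; move/negP: xab; apply.
have : `[a, b]%classic x by apply/Xab/fX; exact: subset_closure.
by rewrite /= in_itv.
Qed.

Lemma vanishing_test_function (X : set R) a b f : smooth f -> vanishes_off a b f ->
  `[a, b] `<=` X -> test_function X f.
Proof.
move=> sf /tsupport_sub fab abX; apply/test_functionE; split => //.
  apply: (@subclosed_compact _ _ `[a, b]%classic) => //.
    exact: closed_closure.
  exact: segment_compact.
exact: subset_trans fab abX.
Qed.

Lemma test_function_itv (X : set R) f : test_function X f ->
  (exists a b : R, [/\ X a, X b & vanishes_off a b f]) \/ (forall x, f x = 0).
Proof.
move=> /test_functionE[_ cf fX].
have [[x fx]|f0] := pselect (exists x, f x != 0); last first.
  by right => x; apply: contrapT => /eqP fx; apply: f0; exists x.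
left; have fx0 : tsupport f !=set0 by exists x; exact: subset_closure.
have cid : {within tsupport f, continuous (id : R -> R)}.
  by apply: continuous_subspaceT => y; exact: cvg_id.
have [b bf bmax] := compact_EVT_max fx0 cf cid.
have [a af amin] := compact_EVT_min fx0 cf cid.
exists a, b; split; first by apply: fX; exact/set_mem.
  by apply: fX; exact/set_mem.
move=> y yab; apply: contrapT => /eqP fy; move/negP: yab; apply.
have yf : y \in tsupport f by apply/mem_set; exact: subset_closure.
by rewrite (amin _ yf) (bmax _ yf).
Qed.

Lemma distribution0 (X : set R) L : distribution_on X L -> L (fun=> 0) = 0.
Proof.
move=> [Llin _].
have T0 : test_function X (fun=> 0).
  apply: (@vanishing_test_function _ 1 0) => //; first exact: smooth_cst.
  by rewrite set_itv_ge ?bnd_simp ?lt_geF ?ltr01//; exact: sub0set.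
have e : (fun x : R => 1 * (0 : R) + 0) = fun=> 0.
  by apply/funext => x; rewrite mul1r addr0.
have := Llin 1 _ _ T0 T0; rewrite e mul1r => /eqP.
by rewrite -subr_eq0 opprD addNKr oppr_eq0 => /eqP.
Qed.

Lemma distribution_sum (X : set R) L (a b : R) M (c : 'I_M -> R)
    (e : 'I_M -> R -> R) : distribution_on X L -> `[a, b] `<=` X ->
  (forall k, smooth (e k)) -> (forall k, vanishes_off a b (e k)) ->
  L (fun x => \sum_k c k * e k x) = \sum_k c k * L (e k).
Proof.
move=> LX abX se e0; have [Llin _] := LX.
have T f : smooth f -> vanishes_off a b f -> test_function X f.
  by move=> sf f0; exact: vanishing_test_function sf f0 abX.
elim: M c e se e0 => [|M IH] c e se e0.
  under eq_fun do rewrite big_ord0; rewrite big_ord0.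
  exact: (distribution0 LX).
under eq_fun do rewrite big_ord_recl.
rewrite big_ord_recl Llin; last 2 first.
- exact: T.
- apply: T; first exact: smooth_sum.
  by move=> x xab; apply: big1 => k _; rewrite e0// mulr0.
by congr (_ + _); apply: IH.
Qed.

End CompactSupport.

(** * Weak approximation of distributions by Dirac masses *)

Lemma cvg_sum_ord {R : realType} (T : Type) (F : set_system T) {FF : Filter F} n
    (f : 'I_n -> T -> R) (a : 'I_n -> R) :
  (forall i, f i x @[x --> F] --> a i) ->
  \sum_i f i x @[x --> F] --> \sum_i a i.
Proof.
elim: n f a => [|n IH] f a fa.
  by rewrite big_ord0; under eq_fun do rewrite big_ord0; exact: cvg_cst.
rewrite big_ord_recl; under eq_fun do rewrite big_ord_recl.
by apply: cvgD => //; exact: IH.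
Qed.

Lemma cvg_sum_ord0 {R : realType} (T : Type) (F : set_system T) {FF : Filter F} n
    (f : 'I_n -> T -> R) (c : R) : (forall i, f i x @[x --> F] --> (0 : R)) ->
  c * \sum_i f i x @[x --> F] --> (0 : R).
Proof.
move=> f0; have : c * \sum_i f i x @[x --> F] --> c * \sum_(i < n) (0 : R).
  by apply: cvgM; [exact: cvg_cst|exact: cvg_sum_ord].
by rewrite big1_eq mulr0.
Qed.

Section RiemannSum.
Context {R : realType}.

(** [F y - y * G c] has derivative [G y - G c], which is small on the cell. *)
Lemma midpoint_cell (F G G' : R -> R) (D a h : R) : 0 <= h ->
  (forall y : R, is_derive y 1 F (G y)) ->
  (forall y : R, is_derive y 1 G (G' y)) ->
  (forall y, a <= y <= a + h -> `|G' y| <= D) ->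
  `|h * G (a + h / 2) - (F (a + h) - F a)| <= D * h * h.
Proof.
move=> h0 FG GG' GD; set c := a + h / 2.
have -> : h * G c - (F (a + h) - F a) =
    - ((F (a + h) - (a + h) * G c) - (F a - a * G c)) by ring.
rewrite normrN.
have ahE : `|a + h - a| = h by rewrite addrAC subrr add0r ger0_norm.
apply: (@le_trans _ _ (D * h * `|a + h - a|)); last by rewrite ahE.
apply: (@normr_lipschitz _ (fun y => F y - y * G c) (fun y => G y - G c)).
  move=> y _; apply: is_derive_eq (derB (FG y) (derM (der_id y) (der_cst (G c) y))) _.
  by rewrite mul1r mulr0 addr0.
move=> y yah.
have D0 : 0 <= D by apply: le_trans (GD a _); rewrite ?normr_ge0// lexx lerDl.
apply: (@le_trans _ _ (D * `|y - c|)).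
  apply: (@normr_lipschitz _ G G' D _ _ (fun z _ => GG' z)) => z zyc.
  by apply: GD; move: zyc yah; rewrite /c; lra.
by rewrite ler_wpM2l// ler_norml; move: yah; rewrite /c; lra.
Qed.

Lemma midpoint_riemann (F G G' : R -> R) (D l : R) M : 0 <= l -> (0 < M)%N ->
  (forall y : R, is_derive y 1 F (G y)) ->
  (forall y : R, is_derive y 1 G (G' y)) ->
  (forall y, 0 <= y <= l -> `|G' y| <= D) ->
  `|\sum_(k < M) l / M%:R * G ((k%:R + 2^-1) * (l / M%:R)) - (F l - F 0)|
    <= D * l * (l / M%:R).
Proof.
move=> l0 M0 FG GG' GD; set h := l / M%:R.
have M0' : 0 < M%:R :> R by rewrite ltr0n.
have h0 : 0 <= h by rewrite divr_ge0// ltW.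
have Mh : M%:R * h = l by rewrite /h mulrCA mulfV ?mulr1// gt_eqF.
have -> : F l - F 0 = \sum_(k < M) (F (k%:R * h + h) - F (k%:R * h)).
  rewrite -(big_mkord xpredT (fun k => F (k%:R * h + h) - F (k%:R * h))).
  rewrite (eq_bigr (fun k => F (k.+1%:R * h) - F (k%:R * h))) => [|k _].
    by rewrite (telescope_sumr (fun k => F (k%:R * h)))// Mh mul0r.
  by rewrite -natr1 mulrDl mul1r.
rewrite -sumrB; apply: (le_trans (ler_norm_sum _ _ _)).
have -> : D * l * h = \sum_(k < M) D * h * h.
  by rewrite sumr_const card_ord -mulr_natl -Mh; ring.
apply: ler_sum => k _; rewrite mulrDl [2^-1 * _]mulrC.
apply: midpoint_cell => // y /andP[ky yk]; apply: GD; apply/andP; split.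
  by apply: le_trans ky; rewrite mulr_ge0.
apply: (le_trans yk); rewrite -Mh -{2}[h]mul1r -mulrDl natr1.
by rewrite ler_wpM2r// ler_nat.
Qed.

End RiemannSum.


Section Mollifier.
Context {R : realType}.
Variable l : R.
Hypothesis l0 : 0 < l.

(** [Psi] is the cumulative function of [psi]; it stands for the integrals of
    [psi] and of its rescalings. *)
Definition mollifier (psi Psi : R -> R) : Prop :=
  [/\ smooth psi, vanishes_off 0 l psi, forall x, 0 <= psi x,
      forall x : R, is_derive x 1 Psi (psi x) &
      (forall x, x <= 0 -> Psi x = 0) /\ (forall x, l <= x -> Psi x = 1)].

(** The normalised square of any nonzero function of the right support serves as
    mollifier. *)
Lemma mollifier_of_nonzero (f : R -> R) (x0 : R) :
  smooth f -> vanishes_off 0 l f -> f x0 != 0 ->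
  exists psi Psi, mollifier psi Psi.
Proof.
move=> sf f0 fx0; pose g x := f x * f x.
have sg : smooth g by exact: smoothM.
have [f00 f0l] := smooth_vanishing_ends sf f0.
have g0 x : x <= 0 \/ l <= x -> g x = 0.
  move=> x0l; rewrite /g; have [->|xn0] := eqVneq x 0; first by rewrite f00 mul0r.
  have [->|xnl] := eqVneq x l; first by rewrite f0l mul0r.
  rewrite f0 ?mul0r//; apply/negP => /andP[x0' xl].
  case: x0l => h; [move/negP: xn0|move/negP: xnl]; apply; rewrite eq_le.
    by rewrite h x0'.
  by rewrite h xl.
have gge0 x : 0 <= g x by rewrite /g -expr2 sqr_ge0.
have [G [G0 dG]] := antiderivative_exists (smooth_continuous (n := 0) sg).
have flat a b : a <= b -> (forall x, a <= x <= b -> g x = 0) -> G b = G a.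
  move=> ab gab; apply/eqP; rewrite -subr_eq0 -normr_le0 -(mul0r `|b - a|).
  apply: (normr_lipschitz (fun x _ => dG x)) => x xab.
  by rewrite /derive1n/= gab ?normr0//; move: xab; lra.
have Gneg x : x <= 0 -> G x = 0.
  move=> x0'; rewrite -G0; apply/esym/flat => // y /andP[_ y0].
  by apply: g0; left.
have Gpos x : l <= x -> G x = G l.
  by move=> lx; apply: flat => // y /andP[ly _]; apply: g0; right.
have Gnd a b : a <= b -> G a <= G b.
  move=> ab; have := @ler_increment_der _ (fun=> 0) G (fun=> 0) g a b ab
    (fun x _ => der_cst 0 x) (fun x _ => dG x) (fun x _ => gge0 x).
  by rewrite subrr subr_ge0.
have Gl : G l != 0.
  apply/negP => /eqP Gl0; move/negP: fx0; apply.
  have G00 x : G x = 0.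
    case: (leP x 0) => [/Gneg//|x0']; case: (leP l x) => [/Gpos ->//|xl].
    by apply/eqP; rewrite eq_le -{1}Gl0 -G0 !Gnd// ltW.
  have : g x0 = 0.
    rewrite -[LHS](der_derive1 (dG x0)) (_ : G = fun=> 0); last exact/funext.
    by apply: der_derive1; exact: der_cst.
  by move/eqP; rewrite /g mulf_eq0 orbb.
have Gl0 : 0 < G l by rewrite lt_neqAle eq_sym Gl -G0 Gnd// ltW.
exists (fun x => (G l)^-1 * g x), (fun x => (G l)^-1 * G x); split.
- exact: smoothZ.
- by move=> x /f0 fx; rewrite /= /g fx mulr0 mulr0.
- by move=> x; rewrite mulr_ge0// invr_ge0 ltW.
- by move=> x; apply: derZ; exact: dG.
- by split=> x hx; [rewrite (Gneg x)// mulr0|rewrite (Gpos x)// mulVf].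
Qed.

Section Kernel.
Variables (psi Psi : R -> R) (d : R).
Hypothesis mpsi : mollifier psi Psi.
Hypotheses (d0 : 0 < d) (d4 : d <= 1 / 4).

Let s : R := 1 - 3 * d.
Let arg (x y : R) : R := - (d^-1 * s) * y + (d^-1 * x - l).

(** [kernel y] is an approximate identity at scale [d], with support in the
    interval of length [d l] that starts at [d l + s y]. The contraction by [s]
    keeps this inside [[d l, l - d l]] for all [y] in [[0, l]], so that
    [kernel y] is a test function even when [y] is next to an end point. *)
Definition kernel (y x : R) : R := s * d^-1 * psi (d^-1 * x + (- (d^-1 * s) * y - l)).

Let s0 : 0 < s. Proof. by rewrite /s; move: d4; lra. Qed.
Let s1 : s <= 1. Proof. by rewrite /s; move: d0; lra. Qed.

Lemma kernel_smooth y : smooth (kernel y).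
Proof. by case: mpsi => spsi _ _ _ _; apply: smoothZ; exact: smooth_affine. Qed.

Lemma derive1n_kernel y n x : derive1n n (kernel y) x =
  s * d^-1 ^+ n.+1 * derive1n n psi (arg x y).
Proof.
case: mpsi => spsi _ _ _ _.
rewrite /kernel derive1nZ; last exact: smooth_affine.
rewrite derive1n_affine// exprS !mulrA; congr (_ * derive1n n psi _).
by rewrite /arg; ring.
Qed.

(** The derivative of order [j] in [x] of [kernel y x], times [phi y], as a
    function of the node [y]. *)
Let dual (phi : R -> R) (x : R) j (y : R) : R :=
  s * d^-1 ^+ j.+1 * (derive1n j psi (arg x y) * phi y).

Let der_arg (f f' : R -> R) (x y : R) : (forall z : R, is_derive z 1 f (f' z)) ->
  is_derive y 1 (fun y => f (arg x y)) (- (d^-1 * s) * f' (arg x y)).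
Proof. by move=> ff'; apply: (@der_affine _ f); exact: ff'. Qed.

Let der_dual phi x j (y : R) : smooth phi ->
  is_derive y 1 (dual phi x j) (s * d^-1 ^+ j.+1 *
    (- (d^-1 * s) * derive1n j.+1 psi (arg x y) * phi y
     + derive1n j psi (arg x y) * derive1n 1 phi y)).
Proof.
move=> sphi; case: mpsi => spsi _ _ _ _.
apply: derZ; apply: derM; last exact: (smooth_der sphi 0).
by apply: der_arg; exact: smooth_der.
Qed.

Let dargE x y : d * arg x y = x - s * y - d * l.
Proof. by rewrite /arg; field; rewrite gt_eqF. Qed.

Let arg_itv x y : 0 <= arg x y <= l -> 0 <= x - s * y - d * l <= d * l.
Proof.
by move=> /andP[h1 h2]; rewrite -dargE mulr_ge0 ?(ltW d0)//= ler_pM2l.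
Qed.

Lemma kernel_supp (y x : R) : 0 <= y <= l ->
  ~~ (s * y + d * l <= x <= s * y + 2 * d * l) ->
  kernel y x = 0.
Proof.
move=> yl; case: mpsi => _ psi0 _ _ _ h; rewrite /kernel psi0 ?mulr0//.
apply: contra h; have -> : d^-1 * x + (- (d^-1 * s) * y - l) = arg x y.
  by rewrite /arg; ring.
by move=> /arg_itv; lra.
Qed.

(** [kernel] has total mass 1 in the variable [y] and charges only nodes [y] at
    distance at most [11 d l] from [x], where [phi y] is close to [phi x].
    Extending the integration to [[- 2 l, 3 l]], where [phi] is zero off
    [[0, l]], makes the mass exactly 1 even for [x] next to an end point. *)
Lemma smooth_approx phi x F B : smooth phi -> vanishes_off 0 l phi ->
    (forall y : R, is_derive y 1 F (dual phi x 0 y)) ->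
    (forall z, `|derive1n 1 phi z| <= B) ->
  `|F l - F 0 - phi x| <= 11 * d * l * B.
Proof.
move=> sphi phi0 dF phiB; case: mpsi => spsi psi0 psige0 dPsi [Psi0 Psi1].
have B0 : 0 <= B by apply: le_trans (phiB 0).
have [phi00 phi0l] := smooth_vanishing_ends sphi phi0.
have flat a b : a <= b -> (forall y, a <= y <= b -> dual phi x 0 y = 0) ->
    F b = F a.
  move=> ab gab; apply/eqP; rewrite -subr_eq0 -normr_le0 -(mul0r `|b - a|).
  apply: (normr_lipschitz (fun x _ => dF x)) => z zab.
  by rewrite gab ?normr0//; move: zab; lra.
case: (boolP (0 <= x <= l)) => [/andP[x0 xl]|xl]; last first.
  rewrite (phi0 x xl) subr0 (flat 0 l) ?(ltW l0)//.
    by rewrite subrr normr0 !mulr_ge0// ltW.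
  move=> y /andP[y0 yl]; rewrite /dual /derive1n/= psi0 ?mul0r ?mulr0//.
  apply: contra xl => /arg_itv/andP[h1 h2].
  have sy : 0 <= s * y by rewrite mulr_ge0// ltW.
  have sl : s * y <= s * l by rewrite ler_wpM2l// ltW.
  have dl : 0 < d * l by rewrite mulr_gt0.
  by move: sy sl h1 h2; rewrite /s; lra.
have Fr : F (3 * l) = F l.
  apply: flat => [|y /andP[yl _]]; first by move: l0; lra.
  have [->|yl'] := eqVneq y l; first by rewrite /dual phi0l !mulr0.
  rewrite /dual phi0 ?mulr0//; apply/negP => /andP[_ yl''].
  by move: yl'; rewrite eq_le yl yl''.
have Fl : F 0 = F (- 2 * l).
  apply: flat => [|y /andP[_ y0]]; first by move: l0; lra.
  have [->|y0'] := eqVneq y 0; first by rewrite /dual phi00 !mulr0.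
  rewrite /dual phi0 ?mulr0//; apply/negP => /andP[y0'' _].
  by move: y0'; rewrite eq_le y0 y0''.
have dl : 0 < d * l by rewrite mulr_gt0.
have dl4 : 4 * (d * l) <= l by have := ler_wpM2r (ltW l0) d4; lra.
have Pr : Psi (arg x (3 * l)) = 0.
  by apply: Psi0; rewrite -(ler_pM2l d0) mulr0 dargE /s; lra.
have Pl : Psi (arg x (- 2 * l)) = 1.
  by apply: Psi1; rewrite -(ler_pM2l d0) dargE /s; lra.
pose K y := - (11 * d * l * B) * Psi (arg x y).
have -> : 11 * d * l * B = K (3 * l) - K (- 2 * l).
  by rewrite /K Pr Pl; ring.
pose W y := F y + phi x * Psi (arg x y).
have -> : F l - F 0 - phi x = W (3 * l) - W (- 2 * l).
  by rewrite /W Pr Pl Fr Fl; ring.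
have dP y := der_arg x y dPsi.
apply: (@normr_increment_der _ W K _ _ _ _ _
  (fun y _ => derD (dF y) (derZ (phi x) (dP y)))
  (fun y _ => derZ (- (11 * d * l * B)) (dP y))).
  by move: l0; lra.
move=> y /andP[ly yl]; rewrite /dual /derive1n/= expr1.
have -> : s * d^-1 * (psi (arg x y) * phi y) +
    phi x * (- (d^-1 * s) * psi (arg x y)) =
  d^-1 * s * psi (arg x y) * (phi y - phi x) by ring.
have -> : - (11 * d * l * B) * (- (d^-1 * s) * psi (arg x y)) =
  d^-1 * s * psi (arg x y) * (B * (11 * d * l)) by ring.
have dsp : 0 <= d^-1 * s * psi (arg x y).
  by rewrite !mulr_ge0// ?invr_ge0 ?ltW.
rewrite normrM (ger0_norm dsp).
case: (boolP (0 <= arg x y <= l)) => [/arg_itv/andP[h1 h2]|/psi0 ->]; last first.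
  by rewrite !mulr0 !mul0r.
rewrite ler_wpM2l//.
apply: (@le_trans _ _ (B * `|y - x|)).
  apply: (@normr_lipschitz _ phi (derive1n 1 phi) _ _ _
    (fun z _ => smooth_der sphi 0 z)) => z _; exact: phiB.
rewrite ler_wpM2l// ler_norml.
have := ler_wpM2l (ltW d0) ly; have := ler_wpM2l (ltW d0) yl.
by move: h1 h2; rewrite /s; lra.
Qed.

(** Each integration by parts moves a derivative from the kernel to [phi] and, the
    node entering through [s y], costs a factor [s]. *)
Lemma smooth_approx_derive phi x F B j : smooth phi -> vanishes_off 0 l phi ->
    (forall y : R, is_derive y 1 F (dual phi x j y)) ->
    (forall z, `|derive1n j.+1 phi z| <= B) ->
  `|s ^+ j * (F l - F 0) - derive1n j phi x| <= 11 * d * l * B.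
Proof.
elim: j phi F => [|j IH] phi F sphi phi0 dF phiB.
  by rewrite expr0 mul1r; exact: smooth_approx.
have [phi00 phi0l] := smooth_vanishing_ends sphi phi0.
pose H y := d^-1 ^+ j.+1 * (derive1n j psi (arg x y) * phi y).
have dH (y : R) : is_derive y 1 H (d^-1 ^+ j.+1 *
    (- (d^-1 * s) * derive1n j.+1 psi (arg x y) * phi y
     + derive1n j psi (arg x y) * derive1n 1 phi y)).
  case: mpsi => spsi _ _ _ _.
  apply: derZ; apply: derM; last exact: (smooth_der sphi 0).
  by apply: der_arg; exact: smooth_der.
have dG (y : R) : is_derive y 1 (fun y => s * (F y + H y))
    (dual (derive1 phi) x j y).
  apply: is_derive_eq (derZ s (derD (dF y) (dH y))) _.
  by rewrite /dual !exprS /derive1n/=; ring.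
(* integration by parts, carried out on the antiderivatives *)
have := IH (derive1 phi) _ (smooth_derive1 sphi) (vanishes_off_derive1 phi0) dG.
rewrite !derive1nSr => /(_ phiB).
by rewrite {1 2}/H phi00 phi0l !mulr0 !addr0 -mulrBr mulrA -exprSr.
Qed.

Definition node M k : R := (k%:R + 2^-1) * (l / M%:R).

Lemma node_itv M (k : 'I_M) : 0 < node M k < l.
Proof.
have M0 : 0 < M%:R :> R by rewrite ltr0n; apply: leq_trans (ltn_ord k).
have kM : k%:R + 1 <= M%:R :> R by rewrite natr1 ler_nat.
have k0 : 0 <= k%:R :> R by [].
have k1 : 0 < k%:R + 2^-1 :> R by lra.
rewrite /node mulrA; apply/andP; split.
  by rewrite divr_gt0// mulr_gt0.
rewrite ltr_pdivrMr// mulrC ltr_pM2l//; lra.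
Qed.

Definition quasi_interpolant M (phi : R -> R) (x : R) : R :=
  \sum_(k < M) (l / M%:R * phi (node M k)) * kernel (node M k) x.

(** The three terms are the error of the Riemann sum, the error of the
    convolution, and the effect of the contraction by [s]. *)
Lemma quasi_interpolant_error M phi j x A A' B0 B1 Bj Bj' : (0 < M)%N ->
    smooth phi -> vanishes_off 0 l phi ->
    (forall z, `|derive1n j psi z| <= A) ->
    (forall z, `|derive1n j.+1 psi z| <= A') ->
    (forall z, `|phi z| <= B0) -> (forall z, `|derive1n 1 phi z| <= B1) ->
    (forall z, `|derive1n j phi z| <= Bj) ->
    (forall z, `|derive1n j.+1 phi z| <= Bj') ->
  `|derive1n j (quasi_interpolant M phi) x - derive1n j phi x| <=
    (d^-1 ^+ j.+2 * ((A + A') * (B0 + B1))) * l * (l / M%:R)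
    + s^-1 ^+ j * (11 * d * l * Bj') + `|s^-1 ^+ j - 1| * Bj.
Proof.
move=> M0 sphi phi0 pA pA' pB0 pB1 pBj pBj'.
have A0 : 0 <= A by apply: le_trans (pA 0).
have A'0 : 0 <= A' by apply: le_trans (pA' 0).
have B00 : 0 <= B0 by apply: le_trans (pB0 0).
have B10 : 0 <= B1 by apply: le_trans (pB1 0).
have cdual : continuous (dual phi x j).
  by move=> y; exact: der_continuous (der_dual x j y sphi).
have [_ dF] := primitiveP cdual.
set F := primitive _ in dF.
have -> : derive1n j (quasi_interpolant M phi) x =
    \sum_(k < M) l / M%:R * dual phi x j (node M k).
  rewrite /quasi_interpolant derive1n_sum => [|k]; last exact: kernel_smooth.
  by apply: eq_bigr => k _; rewrite derive1n_kernel /dual; ring.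
have di0 : 0 <= d^-1 by rewrite invr_ge0 ltW.
have s0' : 0 <= s by exact: ltW.
have d1 : 1 <= d^-1.
  rewrite invf_ge1//. move: d4; lra.
have R1 : `|\sum_(k < M) l / M%:R * dual phi x j (node M k) - (F l - F 0)| <=
    (d^-1 ^+ j.+2 * ((A + A') * (B0 + B1))) * l * (l / M%:R).
  apply: (midpoint_riemann (ltW l0) M0 dF (fun y => der_dual x j y sphi)).
  move=> y _; rewrite normrM normrM (ger0_norm (ltW s0)).
  rewrite [`|d^-1 ^+ _|]ger0_norm; last by rewrite exprn_ge0 ?invr_ge0// ltW.
  have P0 : 0 <= d^-1 ^+ j.+2 by rewrite exprn_ge0// invr_ge0 ltW.
  have h1 : `|derive1n j.+1 psi (arg x y) * phi y| <= A' * B0.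
    by rewrite normrM ler_pM.
  have h2 : `|derive1n j psi (arg x y) * derive1n 1 phi y| <= A * B1.
    by rewrite normrM ler_pM.
  have ds0 : 0 <= d^-1 * s by rewrite mulr_ge0.
  have ds1 : d^-1 * s <= d^-1 by rewrite ler_piMr.
  have h3 : `|- (d^-1 * s) * derive1n j.+1 psi (arg x y) * phi y
      + derive1n j psi (arg x y) * derive1n 1 phi y|
      <= d^-1 * ((A + A') * (B0 + B1)).
    apply: le_trans (ler_normD _ _) _.
    rewrite -mulrA normrM normrN (ger0_norm ds0).
    have := ler_pM ds0 (normr_ge0 _) ds1 h1.
    have := ler_pM ler01 (normr_ge0 _) d1 h2; rewrite mul1r.
    have : 0 <= d^-1 * (A * B0 + A' * B1).
      by rewrite mulr_ge0// addr_ge0// mulr_ge0.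
    lra.
  rewrite (exprSr _ j.+1) -[leRHS]mulrA -mulrA.
  have e0 : 0 <= d^-1 ^+ j.+1 by rewrite exprn_ge0// invr_ge0 ltW.
  rewrite mulrCA ler_wpM2l//; apply: le_trans h3.
  by rewrite ler_piMl.
have R2 := smooth_approx_derive sphi phi0 dF pBj'.
have sj : 0 <= s^-1 ^+ j by rewrite exprn_ge0// invr_ge0 ltW.
set Q := \sum_(k < M) _ in R1 *.
have -> : Q - derive1n j phi x = (Q - (F l - F 0)) +
    (s^-1 ^+ j * (s ^+ j * (F l - F 0) - derive1n j phi x)
     + (s^-1 ^+ j - 1) * derive1n j phi x).
  rewrite mulrBr mulrA -exprMn mulVf ?gt_eqF// expr1n; ring.
apply: le_trans (ler_normD _ _) _; rewrite -addrA lerD//.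
apply: le_trans (ler_normD _ _) _; rewrite lerD//.
  by rewrite normrM (ger0_norm sj) ler_wpM2l.
by rewrite normrM ler_wpM2l.
Qed.

End Kernel.

Section Approximation.
Variables (psi Psi : R -> R).
Hypothesis mpsi : mollifier psi Psi.

Lemma kernel_vanishes (d y : R) : 0 < d -> d <= 1 / 4 -> 0 <= y <= l ->
  vanishes_off (d * l) (l - d * l) (kernel psi d y).
Proof.
move=> d0 d4 yl x xd; apply: (kernel_supp mpsi d0 yl); apply: contra xd.
move: yl => /andP[y0 yl].
have := ler_wpM2l (ltW d0) yl; have := mulr_ge0 (ltW d0) y0.
have s0 : 0 <= 1 - 3 * d by lra.
have := ler_wpM2l s0 yl; have := mulr_ge0 s0 y0.
by lra.
Qed.

(** The support of a quasi-interpolant stays in a neighbourhood of the support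
    of [phi] that does not depend on the scale [d]: a distribution is then
    used with one fixed order. *)
Lemma quasi_interpolant_vanishes (d : R) M (a b : R) phi : 0 < d -> d <= 1 / 4 ->
  0 <= a -> b <= l -> vanishes_off a b phi ->
  vanishes_off (a / 4) ((l + b) / 2) (quasi_interpolant psi d M phi).
Proof.
move=> d0 d4 a0 bl phi0 x xab; apply: big1 => k _.
have /andP[k0 kl] := node_itv k.
case: (boolP (a <= node M k <= b)) => [/andP[ak kb]|/phi0 ->]; last first.
  by rewrite mulr0 mul0r.
suff -> : kernel psi d (node M k) x = 0 by rewrite mulr0.
apply: (kernel_supp mpsi d0); first by rewrite !ltW.
apply: contra xab.
have s0 : 0 <= 1 - 3 * d by lra.
have := ler_wpM2l s0 ak; have := ler_wpM2l s0 kb.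
have := mulr_ge0 (ltW d0) a0.
have : 0 <= (1 / 4 - d) * a by rewrite mulr_ge0// subr_ge0.
have : 0 <= (1 / 4 - d) * (l - b) by rewrite mulr_ge0// subr_ge0.
have : 0 <= d * b by rewrite mulr_ge0 ?ltW// (lt_le_trans k0).
by lra.
Qed.

Let d (n : nat) : R := n.+4%:R^-1.
Let N n := (n.+4 ^ n.+4)%N.

Let d0 n : 0 < d n. Proof. by rewrite invr_gt0. Qed.
Let d4 n : d n <= 1 / 4.
Proof. by rewrite div1r lef_pV2 ?posrE// ler_nat. Qed.

Let d_cvg0 : d n @[n --> \oo] --> (0 : R).
Proof.
have := @cvg_harmonic R; rewrite -(cvg_shiftn 3).
by under eq_fun do rewrite addn3.
Qed.

(** The number [N n] of nodes grows faster than any power of the inverse of the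
    scale, so that the error of the Riemann sums is negligible for all
    derivatives at once. *)
Let quasi_interpolant_cvg (a b : R) phi j : 0 <= a -> b <= l -> smooth phi ->
  vanishes_off a b phi -> exists E : R^nat,
    E n @[n --> \oo] --> (0 : R) /\
    forall n x, (j <= n)%N ->
      `|derive1n j (quasi_interpolant psi (d n) (N n) phi) x
        - derive1n j phi x| <= E n.
Proof.
move=> a0 bl sphi phiab.
have phi0 : vanishes_off 0 l phi.
  by move=> x xl; apply: phiab; apply: contra xl; move: a0 bl; lra.
case: (mpsi) => spsi psi0 _ _ _.
have [A A0 hA] := smooth_vanishing_bounded j spsi psi0.
have [A' A'0 hA'] := smooth_vanishing_bounded j.+1 spsi psi0.
have [B0 B00 hB0] := smooth_vanishing_bounded 0 sphi phi0.
have [B1 B10 hB1] := smooth_vanishing_bounded 1 sphi phi0.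
have [Bj Bj0 hBj] := smooth_vanishing_bounded j sphi phi0.
have [Bj' Bj'0 hBj'] := smooth_vanishing_bounded j.+1 sphi phi0.
pose C := (A + A') * (B0 + B1) * l * l.
have C0 : 0 <= C.
  by rewrite !mulr_ge0// ?addr_ge0// ltW.
pose s n : R := (1 - 3 * d n)^-1 ^+ j.
exists (fun n => C * d n + s n * (11 * d n * l * Bj') + `|s n - 1| * Bj); split.
  have : s n @[n --> \oo] --> ((1 - 3 * 0)^-1 ^+ j : R).
    apply: (@cvg_comp _ _ _ _ (fun x : R => x ^+ j)); last exact: exprn_continuous.
    apply: cvgV; first by rewrite mulr0 subr0 oner_neq0.
    by apply: cvgB; [exact: cvg_cst|exact: cvgMr].
  rewrite mulr0 subr0 invr1 expr1n => sE.
  rewrite (_ : 0 = C * 0 + 1 * (11 * 0 * l * Bj') + `|1 - 1 : R| * Bj); last first.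
    by rewrite subrr normr0; ring.
  apply: cvgD; first apply: cvgD.
  - exact: cvgMr.
  - apply: cvgM => //; apply: cvgMl; apply: cvgMl; exact: cvgMr.
  - by apply: cvgMl; apply: cvg_norm; apply: cvgB => //; exact: cvg_cst.
move=> n x jn.
have N0 : (0 < N n)%N by rewrite expn_gt0.
apply: le_trans (quasi_interpolant_error mpsi (d0 n) (d4 n) x N0 sphi phi0
  hA hA' hB0 hB1 hBj hBj') _.
rewrite !lerD2r.
have -> : (d n)^-1 ^+ j.+2 * ((A + A') * (B0 + B1)) * l * (l / (N n)%:R) =
  C * ((d n)^-1 ^+ j.+2 / (N n)%:R) by rewrite /C; ring.
rewrite ler_wpM2l// /d invrK /N natrX.
rewrite ler_pdivrMr ?exprn_gt0// [in leRHS]exprS mulKf ?pnatr_eq0//.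
by rewrite ler_weXn2l ?ler1n// !ltnS leqW.
Qed.

(** A test function and its quasi-interpolants have their supports in a common
    compact subset of [X], where the distribution is of finite order. *)
Lemma mollified_distribution_cvg (X : set R) L : distribution_on X L ->
    (forall x, 0 < x < l -> X x) ->
    (forall phi, test_function X phi -> exists a b : R, [/\ 0 <= a, b <= l,
      vanishes_off a b phi & `[a / 4, (l + b) / 2] `<=` X]) ->
  exists (M : nat -> nat) (c : nat -> nat -> R), forall phi,
    test_function X phi ->
    \sum_(k < M n) c n k * phi (node (M n) k) @[n --> \oo] --> L phi.
Proof.
move=> LX X0l Xab; have [Llin Lcont] := LX.
exists N, (fun n k => l / (N n)%:R * L (kernel psi (d n) (node (N n) k))).
move=> phi tphi; have [a [b [a0 bl phiab abX]]] := Xab phi tphi.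
have [sphi _ _] := (test_functionE _ _).1 tphi.
pose Q n := quasi_interpolant psi (d n) (N n) phi.
have sQ n : smooth (Q n).
  by apply: smooth_sum => k; exact: (kernel_smooth mpsi).
have Qab n : vanishes_off (a / 4) ((l + b) / 2) (Q n).
  exact: quasi_interpolant_vanishes.
have phiab' : vanishes_off (a / 4) ((l + b) / 2) phi.
  by move=> x xab; apply: phiab; apply: contra xab; lra.
have tQ n : test_function X (Q n).
  exact: vanishing_test_function (sQ n) (Qab n) abX.
have LQ n : \sum_(k < N n) l / (N n)%:R * L (kernel psi (d n) (node (N n) k))
    * phi (node (N n) k) = L (Q n).
  have dl0 : 0 < d n * l by rewrite mulr_gt0.
  rewrite (@distribution_sum _ X L (d n * l) (l - d n * l))//.
  - by apply: eq_bigr => k _; ring.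
  - move=> x /=; rewrite in_itv/= => ?; apply: X0l; lra.
  - by move=> k; exact: (kernel_smooth mpsi).
  - move=> k; apply: kernel_vanishes => //.
    by have /andP[? ?] := node_itv k; rewrite !ltW.
under eq_fun do rewrite LQ.
have [C [K HK]] := Lcont _ (@segment_compact _ (a / 4) ((l + b) / 2)) abX.
have Ej j := quasi_interpolant_cvg j a0 bl sphi phiab.
pose E j := projT1 (cid (Ej j)).
have E0 j : E j n @[n --> \oo] --> (0 : R) by case: (projT2 (cid (Ej j))).
have EQ j n x : (j <= n)%N -> `|derive1n j (Q n) x - derive1n j phi x| <= E j n.
  by case: (projT2 (cid (Ej j))) => _; exact.
apply/cvgrPdist_le => e e0.
have S0 : `|C| * \sum_(j < K.+1) E j n @[n --> \oo] --> (0 : R).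
  exact: (@cvg_sum_ord0 _ _ \oo _ K.+1 (fun j : 'I_K.+1 => E j) _ (fun j => E0 j)).
near=> n.
have Kn : (K <= n)%N by near: n; exact: nbhs_infty_ge.
have -> : L phi - L (Q n) = L (fun x => -1 * Q n x + phi x).
  by rewrite Llin// mulN1r addrC.
have sD : smooth (fun x => -1 * Q n x + phi x) by exact: smooth_lin.
have D0 : vanishes_off (a / 4) ((l + b) / 2) (fun x => -1 * Q n x + phi x).
  by move=> x xab; rewrite Qab// phiab'// mulr0 addr0.
apply: le_trans (HK _ (vanishing_test_function sD D0 abX) (tsupport_sub D0)) _.
apply: (@le_trans _ _ (`|C| * \sum_(j < K.+1) E j n)); last first.
  apply: le_trans (ler_norm _) _; rewrite -[X in `|X|]subr0 distrC.
  by near: n; move/cvgrPdist_le : S0; exact.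
have sup_le (j : 'I_K.+1) :
    sup (range (fun x => `|derive1n j (fun x => -1 * Q n x + phi x) x|)) <= E j n.
  apply: ge_sup; first by exists `|derive1n j (fun x => -1 * Q n x + phi x) 0|, 0.
  move=> _ [x _ <-]; rewrite derive1n_lin// mulN1r addrC distrC.
  by apply: EQ; apply: leq_trans Kn; rewrite -ltnS.
have sup_ge0 (j : 'I_K.+1) :
    0 <= sup (range (fun x => `|derive1n j (fun x => -1 * Q n x + phi x) x|)).
  have [B B0 BD] := smooth_vanishing_bounded j sD D0.
  apply: le_trans (normr_ge0 (derive1n j (fun x => -1 * Q n x + phi x) 0)) _.
  apply: sup_ubound; last by exists 0.
  by exists B => _ [x _ <-].
apply: le_trans (ler_wpM2r _ (ler_norm C)) _; first exact: sumr_ge0.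
by rewrite ler_wpM2l//; apply: ler_sum.
Unshelve. all: by end_near. Qed.

End Approximation.

(** Any nonzero test function provides the mollifier. For the closed interval, the
    support of a test function may reach the end points, and the compact set
    used is the interval itself. *)
Lemma distribution_dirac_cvg (X : set R) L : X = `]0, l[%classic \/ X = `[0, l]%classic ->
  distribution_on X L ->
  exists (M : nat -> nat) (c : nat -> nat -> R), forall phi,
    test_function X phi ->
    \sum_(k < M n) c n k * phi (node (M n) k) @[n --> \oo] --> L phi.
Proof.
move=> Xl LX.
have X0l x : 0 < x < l -> X x.
  by case: Xl => -> /andP[x0 xl]; rewrite /= in_itv/= ?x0// !ltW.
have Xab phi : test_function X phi -> exists a b : R, [/\ 0 <= a, b <= l,
      vanishes_off a b phi & `[a / 4, (l + b) / 2] `<=` X].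
  case: Xl => XE tphi; last first.
    exists 0, l; split => //.
      by apply: (test_function_vanishes _ tphi); rewrite XE.
    by rewrite XE => x /=; rewrite !in_itv/=; lra.
  case: (test_function_itv tphi) => [[a [b []]]|phi0].
    rewrite XE /= !in_itv/= => /andP[a0 al] /andP[b0 bl] phi0.
    exists a, b; split; rewrite ?ltW// => x /=; rewrite !in_itv/=; lra.
  exists (l / 2), (l / 2); split; try (move: l0; lra); first by move=> x.
  by rewrite XE => x /=; rewrite !in_itv/=; move: l0; lra.
have [[phi [tphi [x0 phix0]]]|noT] :=
    pselect (exists phi, test_function X phi /\ exists x0, phi x0 != 0).
  have [a [b [a0 bl phiab _]]] := Xab _ tphi.
  have [sphi _ _] := (test_functionE _ _).1 tphi.
  have phi0 : vanishes_off 0 l phi.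
    by move=> x xl; apply: phiab; apply: contra xl; move: a0 bl; lra.
  have [psi [Psi mpsi]] := mollifier_of_nonzero sphi phi0 phix0.
  exact: (mollified_distribution_cvg mpsi LX).
(* without a nonzero test function there is nothing to approximate *)
exists (fun=> 0%N), (fun _ _ => 0) => phi tphi.
have -> : phi = fun=> 0.
  apply/funext => x; apply: contrapT => /eqP phix; apply: noT.
  by exists phi; split => //; exists x.
by rewrite (distribution0 LX); under eq_fun do rewrite big_ord0; exact: cvg_cst.
Qed.

End Mollifier.

(** * Approximation by trigonometric sums *)

Section IntegralOfDerivative.
Context {R : realType}.
Local Notation mu := (@lebesgue_measure R).

Lemma Rintegral_der (X : set R) (l : R) (g F : R -> R) : 0 < l ->
  X = `]0, l[%classic \/ X = `[0, l]%classic -> continuous g ->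
  (forall x : R, is_derive x 1 F (g x)) ->
  \int[mu]_(x in X) g x = F l - F 0.
Proof.
move=> l0 Xl cg dF.
have icc := continuous_integrable_itv 0 l cg.
have -> : \int[mu]_(x in X) g x = \int[mu]_(x in `[0, l]) g x.
  case: Xl => -> //.
  rewrite Rintegral_itv_bndo_bndc ?Rintegral_itv_obnd_cbnd//.
    apply: integrableS icc => //; apply: subset_itvr; by rewrite bnd_simp.
  by apply: integrableS icc => //; exact: subset_itv_oo_cc.
rewrite /Rintegral (@continuous_FTC2 _ g F)//.
- exact: continuous_subspaceT.
- have cF : continuous F by move=> x; exact: der_continuous (dF x).
  split.
  + by move=> x _; have [] := dF x.
  + by apply: cvg_at_right_filter; exact: cF.
  + by apply: cvg_at_left_filter; exact: cF.
- by move=> x _; exact: der_derive1.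
Qed.

End IntegralOfDerivative.

Section Concentration.
Context {R : realType}.
Variables (l y : R) (w g : R -> R).
Hypotheses (y0l : 0 < y < l) (cw : continuous w) (cg : continuous g).
Hypotheses (w0 : forall x, 0 <= x <= l -> 0 <= w x) (wy : 0 < w y).
Hypotheses (g01 : forall x, 0 <= x <= l -> 0 <= g x) (gy : g y = 1).
Hypothesis g1 : forall x, 0 <= x <= l -> x != y -> g x < 1.

Let W m x := w x * g x ^+ m.

Let cW m : continuous (W m).
Proof.
move=> x; apply: cvgM; first exact: cw.
by apply: (@cvg_comp _ _ _ _ (fun x : R => x ^+ m)); [exact: cg|exact: exprn_continuous].
Qed.

Let P m := primitive (W m).
Let dP m (x : R) : is_derive x 1 (P m) (W m x).
Proof. by have [_] := primitiveP (@cW m). Qed.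

Let W0 m x : 0 <= x <= l -> 0 <= W m x.
Proof. by move=> xl; rewrite mulr_ge0 ?exprn_ge0 ?w0 ?g01. Qed.

Definition mass m := P m l - P m 0.

(** The mass of [w g ^+ m] decays more slowly than any geometric sequence of
    ratio less than [g y = 1]. *)
Let mass_lower (r : R) : 0 <= r -> r < 1 ->
  exists2 k : R, 0 < k & forall m, k * r ^+ m <= mass m.
Proof.
move=> r0 r1; case/andP: (y0l) => y0 yl.
have wn : \forall x \near y, w y / 2 < w x.
  apply: (cvgr_gt (w y) (@cw y)); move: wy; lra.
have gn : \forall x \near y, r < g x.
  by apply: (cvgr_gt (g y) (@cg y)); rewrite gy.
have [e /= e0 He] := (nbhs_ballP y _).1 (filterI wn gn).
pose h := Num.min (e / 2) (Num.min y (l - y)).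
have h0 : 0 < h by rewrite !lt_min divr_gt0//= y0 subr_gt0.
have he : h < e.
  by apply: (@le_lt_trans _ _ (e / 2)); [rewrite ge_min lexx|lra].
have hy : h <= y by rewrite !ge_min lexx orbT.
have hl : h <= l - y by rewrite !ge_min lexx !orbT.
have inb x : y - h <= x <= y + h -> w y / 2 < w x /\ r < g x.
  move=> xh; apply: He; rewrite /ball/= distrC ltr_norml; lra.
exists (2 * h * (w y / 2)); first by rewrite !mulr_gt0// divr_gt0.
move=> m.
have nd a b : 0 <= a -> a <= b -> b <= l -> P m a <= P m b.
  move=> a0 ab bl; rewrite -subr_ge0 -(subrr (0 : R)).
  apply: (@ler_increment_der _ (fun=> 0) (P m) (fun=> 0) (W m) a b ab
    (fun x _ => der_cst 0 x) (fun x _ => dP m x)).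
  by move=> x /andP[ax xb]; apply: W0; rewrite (le_trans a0 ax) (le_trans xb).
have := nd 0 (y - h); have := nd (y + h) l.
have : (w y / 2 * r ^+ m) * (y + h) - (w y / 2 * r ^+ m) * (y - h)
    <= P m (y + h) - P m (y - h).
  apply: (@ler_increment_der _ (fun x => (w y / 2 * r ^+ m) * x) (P m)
    (fun=> w y / 2 * r ^+ m * 1) (W m) _ _ _
    (fun x _ => derZ _ (der_id x)) (fun x _ => dP m x)); first lra.
  move=> x /inb[wx gx]; rewrite mulr1 /W.
    apply: ler_pM; [|by rewrite exprn_ge0|exact: ltW|].
    by rewrite divr_ge0// ltW.
  have gx' := ltW gx.
  by rewrite lerXn2r ?nnegrE// (le_trans r0).
rewrite /mass; lra.
Qed.

Lemma mass_gt0 m : 0 < mass m.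
Proof.
have h0 : 0 <= 2^-1 :> R by rewrite invr_ge0.
have h1 : 2^-1 < 1 :> R by rewrite invf_lt1// ltr1n.
have [k k0 hk] := mass_lower h0 h1.
by apply: lt_le_trans (hk m); rewrite mulr_gt0// exprn_gt0// invr_gt0.
Qed.

Definition concentrated m x := w x * (g x ^+ m / mass m).

(** Laplace's method: away from [y] the power [g ^+ m] is at most [r ^+ m], while
    its mass near [y] decays more slowly. *)
Lemma concentrated_dirac (e : R) : 0 < e -> exists m, forall phi F B0 B1,
    smooth phi -> (forall x, `|phi x| <= B0) ->
    (forall x, `|derive1n 1 phi x| <= B1) ->
    (forall x : R, is_derive x 1 F (concentrated m x * phi x)) ->
  `|F l - F 0 - phi y| <= e * (B0 + B1).
Proof.
move=> e0; case/andP: (y0l) => y0 yl.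
pose h := Num.min e y.
have h0 : 0 < h by rewrite lt_min e0.
have he : h <= e by rewrite ge_min lexx.
have hy : h <= y by rewrite ge_min lexx orbT.
pose A := `[0, l]%classic `&` ~` `]y - h, y + h[%classic.
have A0 : A 0.
  split; rewrite /= in_itv/= ?lexx ?(ltW (lt_trans y0 yl))//.
  by apply/negP; rewrite negb_and -!leNgt subr_ge0 hy.
have cA : compact A.
  apply: (@subclosed_compact _ _ `[0, l]%classic).
  - apply: closedI; first exact: itv_closed.
    by apply: open_closedC; exact: itv_open.
  - exact: segment_compact.
  - by move=> x [].
have [z zA zmax] := @compact_EVT_max _ _ g A (ex_intro _ 0 A0) cA
  (continuous_subspaceT cg).
pose r := g z.
have [zl zy] : 0 <= z <= l /\ z != y.
  move: zA; rewrite inE => -[]; rewrite /= in_itv/= => zl zh; split=> //.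
  apply/eqP => zy; apply: zh; rewrite /= in_itv/= zy; apply/andP; split; lra.
have r0 : 0 <= r by exact: g01.
have r1 : r < 1 by exact: g1.
have far x : 0 <= x <= l -> h <= `|x - y| -> g x <= r.
  move=> xl xh; apply: zmax; rewrite inE; split; rewrite /= in_itv//=.
  by move=> /andP[? ?]; move: xh; rewrite leNgt ltr_norml => /negP; apply; lra.
have [c _ cmax] : exists2 c, c \in `[0, l] & forall t, t \in `[0, l] -> w t <= w c.
  by apply: EVT_max; [lra|exact: continuous_subspaceT].
have wc0 : 0 < w c by apply: lt_le_trans (cmax y _); rewrite // in_itv/= !ltW.
pose r' := (1 + r) / 2.
have r'0 : 0 < r' by rewrite /r'; lra.
have r'1 : r' < 1 by rewrite /r'; lra.
have [k k0 hk] := mass_lower (ltW r'0) r'1.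
have [m hm] : exists m, 2 * w c * l * (r / r') ^+ m <= e * k.
  have q1 : `|r / r'| < 1.
    have q0 : 0 <= r / r' by rewrite divr_ge0// ltW.
    rewrite ger0_norm// ltr_pdivrMr// mul1r /r'; lra.
  have /cvgrPdist_le := cvg_geometric (2 * w c * l) q1.
  move=> /(_ (e * k) (mulr_gt0 e0 k0)) [m _ /(_ m (leqnn m))] /=.
  rewrite sub0r normrN => /(le_trans (ler_norm _)) ?.
  by exists m.
exists m => phi F B0 B1 sphi pB0 pB1 dF.
have M0 := mass_gt0 m.
have B00 : 0 <= B0 by apply: le_trans (pB0 0).
have B10 : 0 <= B1 by apply: le_trans (pB1 0).
have l0 : 0 < l by lra.
pose G x := F x - phi y * ((mass m)^-1 * P m x).
have -> : F l - F 0 - phi y = G l - G 0.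
  have MM : (mass m)^-1 * (P m l - P m 0) = 1 by rewrite mulVf// gt_eqF.
  rewrite -[X in _ - X = _]mulr1 -MM /G; ring.
pose K x := (mass m)^-1 * (e * B1 * P m x + 2 * B0 * w c * r ^+ m * x).
have Kl : K l - K 0 <= e * (B0 + B1).
  have -> : K l - K 0 = (mass m)^-1 * (e * B1 * mass m + 2 * B0 * w c * r ^+ m * l).
    by rewrite /K /mass; ring.
  suff : 2 * B0 * w c * r ^+ m * l <= e * B0 * mass m.
    by rewrite ler_pdivrMl//; lra.
  apply: (@le_trans _ _ (e * B0 * (k * r' ^+ m))); last first.
    by rewrite ler_wpM2l ?mulr_ge0// ltW.
  have -> : r ^+ m = (r / r') ^+ m * r' ^+ m.
    by rewrite -exprMn divfK// gt_eqF.
  have := ler_wpM2r (mulr_ge0 B00 (exprn_ge0 m (ltW r'0))) hm.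
  by lra.
apply: le_trans Kl.
apply: (@normr_increment_der _ G K
  (fun x => concentrated m x * phi x - phi y * ((mass m)^-1 * W m x))
  (fun x => (mass m)^-1 * (e * B1 * W m x + 2 * B0 * w c * r ^+ m * 1)) _ _ (ltW l0)
  (fun x _ => derB (dF x) (derZ _ (derZ _ (dP m x))))
  (fun x _ => derZ _ (derD (derZ _ (dP m x)) (derZ _ (der_id x))))).
move=> x xl; rewrite mulr1.
have -> : concentrated m x * phi x - phi y * ((mass m)^-1 * W m x) =
    (mass m)^-1 * (W m x * (phi x - phi y)) by rewrite /concentrated /W; ring.
rewrite normrM ger0_norm ?invr_ge0 ?(ltW M0)// ler_wpM2l ?invr_ge0 ?(ltW M0)//.
rewrite normrM (ger0_norm (W0 m xl)).
case: (leP h `|x - y|) => xh; last first.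
  apply: (@le_trans _ _ (W m x * (B1 * e))); last first.
    rewrite [leRHS]addrC ler_wpDl//; last first.
      by rewrite le_eqVlt; apply/orP; left; apply/eqP; ring.
    by rewrite !mulr_ge0 ?exprn_ge0// ltW.
  rewrite ler_wpM2l ?W0//; apply: (@le_trans _ _ (B1 * `|x - y|)).
    by apply: (normr_lipschitz (fun z _ => smooth_der sphi 0 z)) => ? _; exact: pB1.
  by rewrite ler_wpM2l// (le_trans (ltW xh)).
apply: (@le_trans _ _ (w c * r ^+ m * (B0 + B0))); last first.
  have := mulr_ge0 (mulr_ge0 (ltW e0) B10) (W0 m xl); lra.
apply: ler_pM => //; first exact: W0.
  have gx0 := g01 xl; have gxr := far x xl xh.
  rewrite /W; apply: ler_pM; [exact: w0|by rewrite exprn_ge0| |].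
    by apply: cmax; rewrite in_itv.
  by rewrite lerXn2r ?nnegrE.
by apply: le_trans (ler_normB _ _) _; rewrite lerD.
Qed.

End Concentration.

Section CosineSums.
Context {R : realType}.

(** The condition on the frequencies says that they are multiples of [pi / l],
    without mentioning integers. *)
Definition cos_sum (l : R) (f : R -> R) : Prop :=
  exists (J : nat) (b om : 'I_J -> R),
    (forall j, sin (om j * l) = 0) /\ f = fun x => \sum_j b j * cos (om j * x).

Lemma cos_sum_fintype (l : R) (I : finType) (b om : I -> R) :
  (forall i, sin (om i * l) = 0) ->
  cos_sum l (fun x => \sum_i b i * cos (om i * x)).
Proof.
move=> oml; exists #|I|, (b \o enum_val), (om \o enum_val); split.
  by move=> j; exact: oml.
by apply/funext => x; rewrite (reindex _ (onW_bij _ (@enum_val_bij I))).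
Qed.

Lemma cos_sum_cst (l c : R) : cos_sum l (fun=> c).
Proof.
have := @cos_sum_fintype l unit (fun=> c) (fun=> 0).
rewrite mul0r sin0 => /(_ (fun=> erefl)).
by under eq_fun do rewrite big_const card_unit/= addr0 mul0r cos0 mulr1.
Qed.

Lemma cos_sum_lin (l c : R) f g : cos_sum l f -> cos_sum l g ->
  cos_sum l (fun x => c * f x + g x).
Proof.
move=> [J [b [om [oml ->]]]] [J' [b' [om' [oml' ->]]]].
have := @cos_sum_fintype l ('I_J + 'I_J')%type
  (fun i => match i with inl j => c * b j | inr j => b' j end)
  (fun i => match i with inl j => om j | inr j => om' j end).
have H i : sin ((match i with inl j => om j | inr j => om' j end) * l) = 0.
  by case: i.
move=> /(_ H); congr (cos_sum l _); apply/funext => x.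
rewrite big_sumType/= mulr_sumr; congr (_ + _).
by apply: eq_bigr => j _; rewrite mulrA.
Qed.

Lemma cos_sumM (l : R) f g : cos_sum l f -> cos_sum l g ->
  cos_sum l (fun x => f x * g x).
Proof.
move=> [J [b [om [oml ->]]]] [J' [b' [om' [oml' ->]]]].
have := @cos_sum_fintype l ('I_J * 'I_J' * bool)%type
  (fun p => b p.1.1 * b' p.1.2 / 2)
  (fun p => om p.1.1 + (if p.2 then om' p.1.2 else - om' p.1.2)).
have H (p : 'I_J * 'I_J' * bool) :
    sin ((om p.1.1 + (if p.2 then om' p.1.2 else - om' p.1.2)) * l) = 0.
  by case: p.2; rewrite mulrDl ?mulNr sinD oml mul0r ?sinN oml' ?oppr0 mulr0 addr0.
move=> /(_ H); congr (cos_sum l _); apply/funext => x.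
rewrite -(pair_bigA _ (fun (q : 'I_J * 'I_J') (e : bool) => b q.1 * b' q.2 / 2 *
  cos ((om q.1 + (if e then om' q.2 else - om' q.2)) * x)))/=.
rewrite -(pair_bigA _ (fun (i : 'I_J) (j : 'I_J') => \sum_(e : bool)
  b i * b' j / 2 * cos ((om i + (if e then om' j else - om' j)) * x)))/=.
rewrite mulr_suml; apply: eq_bigr => i _.
rewrite mulr_sumr; apply: eq_bigr => j _.
by rewrite big_bool/= !mulrDl mulNr cosD cosB; field.
Qed.

Lemma cos_sumX (l : R) f m : cos_sum l f -> cos_sum l (fun x => f x ^+ m).
Proof.
move=> fl; elim: m => [|m IH]; first exact: cos_sum_cst.
by under eq_fun do rewrite exprS; exact: cos_sumM.
Qed.

Lemma cos_sum_sum (l : R) n (c : 'I_n -> R) (f : 'I_n -> R -> R) :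
  (forall i, cos_sum l (f i)) -> cos_sum l (fun x => \sum_i c i * f i x).
Proof.
elim: n c f => [|n IH] c f fl.
  by under eq_fun do rewrite big_ord0; exact: cos_sum_cst.
by under eq_fun do rewrite big_ord_recl; apply: cos_sum_lin => //; exact: IH.
Qed.

Lemma cos_sum_cos (l : R) : l != 0 -> cos_sum l (fun x => cos (pi / l * x)).
Proof.
move=> l0; have := @cos_sum_fintype l unit (fun=> 1) (fun=> pi / l).
rewrite divfK// sinpi => /(_ (fun=> erefl)).
by under eq_fun do rewrite big_const card_unit/= addr0 mul1r.
Qed.

Lemma cos_sum_smooth (l : R) f : cos_sum l f -> smooth f.
Proof.
by move=> [J [b [om [_ ->]]]]; apply: smooth_sum => j; exact: smooth_cos.
Qed.

(** A cosine sum whose maximum over [[0, l]] is attained at [y] only, the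
    function [x |-> cos (pi / l * x)] being injective there. *)
Definition cos_peak (l y x : R) : R :=
  1 + - (4^-1) * (cos (pi / l * x) - cos (pi / l * y)) ^+ 2.

Lemma cos_peak_sum (l y : R) : l != 0 -> cos_sum l (cos_peak l y).
Proof.
move=> l0; rewrite /cos_peak; under eq_fun do rewrite addrC.
apply: cos_sum_lin; last exact: cos_sum_cst.
apply: cos_sumX; have := cos_sum_lin 1 (cos_sum_cos l0)
  (cos_sum_cst l (- cos (pi / l * y))).
by under eq_fun do rewrite mul1r.
Qed.

Lemma cos_peak_ge0 (l y x : R) : 0 <= cos_peak l y x.
Proof.
rewrite /cos_peak; set u := cos _; set v := cos _.
have : `|u - v| <= 2.
  apply: le_trans (ler_normB _ _) _; rewrite -[2]/(1 + 1 : R).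
  by rewrite lerD// ler_norml cos_geN1 cos_le1.
rewrite -ler_sqr ?nnegrE// real_normK ?num_real//; lra.
Qed.

Lemma cos_peak_lt1 (l y x : R) : 0 < l -> 0 <= y <= l -> 0 <= x <= l ->
  x != y -> cos_peak l y x < 1.
Proof.
move=> l0 yl xl xy; rewrite /cos_peak gtrDl mulNr oppr_lt0 mulr_gt0 ?invr_gt0//.
rewrite lt_neqAle sqr_ge0 andbT eq_sym sqrf_eq0 subr_eq0.
have lpi z : 0 <= z <= l -> pi / l * z \in `[0, pi].
  move=> /andP[z0 zl]; rewrite in_itv/=.
  have pl : 0 <= pi / l :> R by rewrite divr_ge0 ?pi_ge0 ?ltW.
  rewrite mulr_ge0//= -[leRHS](divfK (lt0r_neq0 l0)).
  by rewrite ler_wpM2l.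
apply: contra xy => /eqP /(cos_inj (lpi _ xl) (lpi _ yl)) /eqP.
rewrite (inj_eq (mulfI _))// mulf_neq0 ?invr_neq0 ?gt_eqF ?pi_gt0//.
Qed.

End CosineSums.

Section TrigonometricApproximation.
Context {R : realType}.

(** The weight [w] is 1 for cosine sums; with [w x = sin (pi * x)] the
    approximations vanish at the end points of [[0, 1]]. *)
Lemma distribution_trig_cvg (l : R) (X : set R) L (w : R -> R) : 0 < l ->
    X = `]0, l[%classic \/ X = `[0, l]%classic -> distribution_on X L ->
    continuous w -> (forall x, 0 <= x <= l -> 0 <= w x) ->
    (forall x, 0 < x < l -> 0 < w x) ->
  exists p : nat -> R -> R, (forall n, cos_sum l (p n)) /\
    forall phi, test_function X phi ->
      distr_of X (fun x => w x * p n x) phi @[n --> \oo] --> L phi.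
Proof.
move=> l0 Xl LX cw w0 wpos.
have [M [c Lc]] := distribution_dirac_cvg l0 Xl LX.
pose e n : R := (n.+1%:R * (1 + \sum_(k < M n) `|c n k|))^-1.
have S0 n : 0 < 1 + \sum_(k < M n) `|c n k|.
  by rewrite ltr_wpDr// sumr_ge0.
have e0 n : 0 < e n by rewrite invr_gt0 mulr_gt0.
have peak n (k : 'I_(M n)) : exists f, cos_sum l f /\
    forall phi F B0 B1, smooth phi -> (forall x, `|phi x| <= B0) ->
    (forall x, `|derive1n 1 phi x| <= B1) ->
    (forall x : R, is_derive x 1 F (w x * f x * phi x)) ->
    `|F l - F 0 - phi (node l (M n) k)| <= e n * (B0 + B1).
  have yl := node_itv l0 k; set y := node l (M n) k in yl *.
  have ycl : 0 <= y <= l by case/andP: yl => ? ?; rewrite !ltW.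
  have lN0 : l != 0 by rewrite gt_eqF.
  have sg := cos_sum_smooth (cos_peak_sum y lN0).
  have gy : cos_peak l y y = 1 by rewrite /cos_peak subrr expr0n/= mulr0 addr0.
  have [m Hm] := concentrated_dirac yl cw (smooth_continuous (n := 0) sg) w0
    (wpos y yl) (fun x _ => cos_peak_ge0 l y x) gy
    (fun x xl => cos_peak_lt1 l0 ycl xl) (e0 n).
  exists (fun x => cos_peak l y x ^+ m / mass l w (cos_peak l y) m); split => //.
  have := cos_sum_lin (mass l w (cos_peak l y) m)^-1
    (cos_sumX m (cos_peak_sum y lN0)) (cos_sum_cst l 0).
  by under eq_fun do rewrite addr0 mulrC.
pose f n k := projT1 (cid (peak n k)).
have fcos n k : cos_sum l (f n k) by case: (projT2 (cid (peak n k))).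
exists (fun n x => \sum_(k < M n) c n k * f n k x); split.
  by move=> n; apply: cos_sum_sum.
move=> phi tphi; have [sphi _ _] := (test_functionE _ _).1 tphi.
have phi0 : vanishes_off 0 l phi.
  apply: (test_function_vanishes _ tphi).
  by case: Xl => -> //; exact: subset_itv_oo_cc.
have [B0 B00 hB0] := smooth_vanishing_bounded 0 sphi phi0.
have [B1 B10 hB1] := smooth_vanishing_bounded 1 sphi phi0.
pose S n := \sum_(k < M n) c n k * phi (node l (M n) k).
have close n : `|distr_of X (fun x => w x * \sum_(k < M n) c n k * f n k x) phi
    - S n| <= (B0 + B1) * n.+1%:R^-1.
  have cfk k : continuous (fun x => w x * f n k x * phi x).
    move=> x; apply: cvgM; last exact: (smooth_continuous (n := 0) sphi).
    apply: cvgM; first exact: cw.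
    exact: (smooth_continuous (n := 0) (cos_sum_smooth (fcos n k))).
  pose F k := primitive (fun x => w x * f n k x * phi x).
  have dF k (x : R) : is_derive x 1 (F k) (w x * f n k x * phi x).
    by have [_] := primitiveP (cfk k).
  have -> : distr_of X (fun x => w x * \sum_(k < M n) c n k * f n k x) phi =
      \sum_(k < M n) c n k * (F k l - F k 0).
    have dsum (x : R) : is_derive x 1 (fun x => \sum_(k < M n) c n k * F k x)
        (\sum_(k < M n) c n k * (w x * f n k x * phi x)).
      by apply: der_sum => k; exact: derZ.
    rewrite /distr_of; under eq_Rintegral => x _.
      rewrite (_ : _ * _ = \sum_(k < M n) c n k * (w x * f n k x * phi x)).
        over.
      by rewrite mulr_sumr mulr_suml; apply: eq_bigr => k _; ring.
    rewrite (Rintegral_der l0 Xl _ dsum).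
      by rewrite -sumrB; apply: eq_bigr => k _; rewrite mulrBr.
    move=> x; apply: cvg_sum_ord => k; apply: cvgM; first exact: cvg_cst.
    exact: cfk.
  rewrite /S -sumrB.
  apply: (@le_trans _ _ (\sum_(k < M n) `|c n k| * (e n * (B0 + B1)))).
    apply: le_trans (ler_norm_sum _ _ _) _; apply: ler_sum => k _.
    rewrite -mulrBr normrM ler_wpM2l//.
    by case: (projT2 (cid (peak n k))) => _; apply.
  rewrite -mulr_suml mulrA mulrC ler_wpM2l ?addr_ge0//.
  by rewrite ler_pdivrMr ?mulr_gt0// mulKf ?pnatr_eq0// lerDr.
have close0 : distr_of X (fun x => w x * \sum_(k < M n) c n k * f n k x) phi
    - S n @[n --> \oo] --> (0 : R).
  apply/cvgr0Pnorm_le => eps eps0.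
  have : (B0 + B1) * harmonic n @[n --> \oo] --> (B0 + B1) * 0.
    by apply: cvgM; [exact: cvg_cst|exact: cvg_harmonic].
  rewrite mulr0 => /cvgr0Pnorm_le /(_ _ eps0); apply: filterS => n /=.
  by apply: le_trans; apply: le_trans (close n) (ler_norm _).
pose D n := distr_of X (fun x => w x * \sum_(k < M n) c n k * f n k x) phi.
rewrite -/D (_ : D = fun n => (D n - S n) + S n); last first.
  by apply/funext => n; rewrite subrK.
by rewrite -[L phi]add0r; apply: cvgD => //; exact: Lc.
Qed.

End TrigonometricApproximation.

(** * The Dyson series of the Schroedinger group *)

Section SeriesSums.
Context {R : realType}.
Implicit Types (f g M : R^nat) (c : R).

Definition sumr f : R := limn (series f).

Lemma dominated_cvg M f c : cvgn (series M) -> (forall m, `|f m| <= c * M m) ->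
  cvgn (series f).
Proof.
move=> cM fM; apply: normed_cvg.
apply: (@series_le_cvg _ _ (fun m => c * M m)) => //= [m|].
  exact: le_trans (normr_ge0 _) (fM m).
rewrite (_ : series _ = c \*: series M); first exact: is_cvgZr.
by apply/funext => n; rewrite /series/= scaler_sumr.
Qed.

Lemma sumrD f g : cvgn (series f) -> cvgn (series g) ->
  sumr (fun m => f m + g m) = sumr f + sumr g.
Proof.
move=> cf cg; rewrite /sumr -limD//; congr (limn _).
by apply/funext => n; rewrite /series/= big_split.
Qed.

Lemma sumrZ f c : cvgn (series f) -> sumr (fun m => c * f m) = c * sumr f.
Proof.
move=> cf; rewrite /sumr; apply/cvg_lim => //.
rewrite (_ : series _ = c \*: series f); first exact: cvgZr.
by apply/funext => n; rewrite /series/= scaler_sumr.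
Qed.

Lemma is_cvg_seriesDr f g : cvgn (series f) -> cvgn (series g) ->
  cvgn (series (fun m => f m + g m)).
Proof.
move=> cf cg; rewrite (_ : series _ = series f + series g); first exact: is_cvgD.
by apply/funext => n; rewrite /series/= big_split.
Qed.

Lemma is_cvg_seriesZr f c : cvgn (series f) -> cvgn (series (fun m => c * f m)).
Proof.
move=> cf; rewrite (_ : series _ = c \*: series f); first exact: is_cvgZr.
by apply/funext => n; rewrite /series/= scaler_sumr.
Qed.

Lemma normr_sumr_le M f c : cvgn (series M) -> (forall m, `|f m| <= c * M m) ->
  `|sumr f| <= c * sumr M.
Proof.
move=> cM fM; have cf := dominated_cvg cM fM.
rewrite -sumrZ// /sumr -lim_norm//.
apply: ler_lim; [exact: is_cvg_norm|exact: is_cvg_seriesZr|].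
near=> n; apply: le_trans (ler_norm_sum _ _ _) _.
by apply: ler_sum => i _.
Unshelve. all: by end_near. Qed.

(** The potential couples each level of the Dyson series to the preceding one. *)
Definition shiftr f : R^nat := fun m => if m is m'.+1 then f m' else 0.

Lemma sumr_shift f : cvgn (series f) ->
  cvgn (series (shiftr f)) /\ sumr (shiftr f) = sumr f.
Proof.
move=> cf; have H : series (shiftr f) n @[n --> \oo] --> sumr f.
  rewrite -cvg_shiftS /=.
  rewrite (_ : (fun _ => _) = series f) //; apply/funext => n.
  by rewrite /series/= big_nat_recl//= add0r.
by split; [apply/cvg_ex; exists (sumr f)|exact/cvg_lim].
Qed.

End SeriesSums.

Section Dyson.
Context {R : realType} (K J : finType).
Variables (kap : K -> R) (u0 : bool -> K -> R) (om b : J -> R).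
Hypothesis sin_kap : forall i, sin (kap i) = 0.
Hypothesis sin_om : forall j, sin (om j) = 0.

Definition cossum (x : R) : R := \sum_j b j * cos (om j * x).

(** A path of length [m] starts with one of the sines of the initial datum and
    records the [m] interactions with the potential: for each of them, the
    cosine involved and whether its frequency is added or subtracted. *)
Fixpoint path_index m : finType :=
  if m is m'.+1 then (path_index m' * (J * bool))%type else K.

Fixpoint freq m : path_index m -> R :=
  match m with
  | 0 => kap
  | m'.+1 => fun p => freq p.1 + (if p.2.2 then om p.2.1 else - om p.2.1)
  end.

(** Complex values are indexed by [bool], [false] for the real and [true] for the
    imaginary part: the component [c] of [i z] is [sg c] times the component
    [~~ c] of [z]. *)
Definition sg (c : bool) : R := if c then 1 else -1.

Lemma sgN c : sg (~~ c) = - sg c.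
Proof. by case: c; rewrite /sg ?opprK. Qed.

Lemma sgsg c : sg c * sg c = 1.
Proof. by case: c; rewrite /sg ?mulrNN mulr1. Qed.

Lemma normr_sg c : `|sg c| = 1.
Proof. by case: c; rewrite /sg ?normrN normr1. Qed.

(** Multiplication of the complex function [P] by [exp (i l s)], the free
    evolution of a mode of frequency squared [l]. *)
Definition rotate (l : R) (P : bool -> R -> R) c s : R :=
  cos (l * s) * P c s + sg c * (sin (l * s) * P (~~ c) s).

(** The component [c] of [i exp (- i l s) F s]. *)
Definition duhamel_integrand (l : R) (F : bool -> R -> R) c s : R :=
  sg c * (cos (l * s) * F (~~ c) s) + sin (l * s) * F c s.

(** The coefficient of a path as a function of time: free evolution of the initial
    coefficient, then Duhamel's formula for each interaction. *)
Fixpoint coef m : path_index m -> bool -> R -> R :=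
  match m with
  | 0 => fun i => rotate (kap i ^+ 2) (fun c _ => u0 c i)
  | m'.+1 => fun p => rotate (freq (p : path_index m'.+1) ^+ 2) (fun c =>
      primitive (duhamel_integrand (freq (p : path_index m'.+1) ^+ 2)
        (fun c s => b p.2.1 / 2 * coef p.1 c s) c))
  end.

(** The term that the last interaction contributes to the equation for the
    coefficient. *)
Definition coef_force m : path_index m -> bool -> R -> R :=
  match m with
  | 0 => fun _ _ _ => 0
  | m'.+1 => fun p c s => b p.2.1 / 2 * coef p.1 c s
  end.

Definition dcoef m (i : path_index m) c s : R :=
  sg c * (freq i ^+ 2 * coef i (~~ c) s + coef_force i (~~ c) s).

Definition dcoef_force m : path_index m -> bool -> R -> R :=
  match m with
  | 0 => fun _ _ _ => 0
  | m'.+1 => fun p c s => b p.2.1 / 2 * dcoef p.1 c s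
  end.

Definition ddcoef m (i : path_index m) c s : R :=
  sg c * (freq i ^+ 2 * dcoef i (~~ c) s + dcoef_force i (~~ c) s).

(** Duhamel's formula: [i l z + i F] is the derivative of the rotation [z] of an
    antiderivative of [i exp (- i l s) F s]. *)
Lemma der_rotate (l : R) (P p F : bool -> R -> R) c (s : R) :
  (forall d, is_derive s 1 (P d) (p d s)) ->
  (forall d, p d s = duhamel_integrand l F d s) ->
  is_derive s 1 (rotate l P c)
    (sg c * (l * rotate l P (~~ c) s + F (~~ c) s)).
Proof.
move=> Pp pF.
apply: is_derive_eq (derD (derM (der_cos_scaled l s) (Pp c))
  (derZ (sg c) (derM (der_sin_scaled l s) (Pp (~~ c))))) _.
rewrite !pF /duhamel_integrand /rotate negbK sgN.
have := cos2Dsin2 (l * s); have := sgsg c.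
move: (cos (l * s)) (sin (l * s)) (sg c) (P c s) (P (~~ c) s) (F c s) (F (~~ c) s).
move=> C S g Pc Pn Fc Fn gg CS.
apply/eqP; rewrite -subr_eq0; apply/eqP.
transitivity ((g * g - 1) * (l * S * Pc - C * S * Fc)
  + g * Fn * (C ^+ 2 + S ^+ 2 - 1)); first by ring.
by rewrite gg CS subrr mul0r mulr0 addr0.
Qed.

Lemma duhamel_integrand_continuous (l : R) (F : bool -> R -> R) c :
  (forall d, continuous (F d)) -> continuous (duhamel_integrand l F c).
Proof.
move=> cF x; rewrite /duhamel_integrand.
have cC : {for x, continuous (fun s => cos (l * s))}.
  exact: der_continuous (der_cos_scaled l x).
have cS : {for x, continuous (fun s => sin (l * s))}.
  exact: der_continuous (der_sin_scaled l x).
apply: cvgD; last by apply: cvgM => //; exact: cF.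
by apply: cvgMr; apply: cvgM => //; exact: cF.
Qed.

Lemma coef_der m (i : path_index m) c (s : R) :
  is_derive s 1 (coef i c) (dcoef i c s).
Proof.
elim: m i c s => [|m IH] i c s.
  rewrite /dcoef/=; apply: (@der_rotate _ _ (fun _ _ => 0) (fun _ _ => 0)) => d.
  by rewrite /duhamel_integrand /= !mulr0 addr0.
rewrite /dcoef/=; set l := (X in rotate X); set F := (X in duhamel_integrand _ X).
have cF d : continuous (F d).
  by move=> x; apply: (der_continuous (derZ _ (IH _ _ _))).
apply: (@der_rotate _ _ (duhamel_integrand l F) F) => // d.
have [_ dP] := primitiveP (duhamel_integrand_continuous (l := l) (c := d) cF); exact: dP.
Qed.

Lemma dcoef_der m (i : path_index m) c (s : R) :
  is_derive s 1 (dcoef i c) (ddcoef i c s).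
Proof.
apply: derZ; apply: derD; first by apply: derZ; exact: coef_der.
case: m i => [|m] i; first exact: der_cst.
by apply: derZ; exact: coef_der.
Qed.

Fixpoint weight m : path_index m -> R :=
  match m with
  | 0 => fun i => `|u0 false i| + `|u0 true i|
  | m'.+1 => fun p => 2 * `|b p.2.1| * weight p.1
  end.

Lemma weight_ge0 m (i : path_index m) : 0 <= weight i.
Proof. by elim: m i => [|m IH] i /=; rewrite ?addr_ge0// !mulr_ge0. Qed.

Lemma normr_rotate_le l P c s (B : R) : (forall d, `|P d s| <= B) ->
  `|rotate l P c s| <= B + B.
Proof.
move=> PB; apply: (le_trans (ler_normD _ _)); apply: lerD.
  rewrite normrM -[B]mul1r ler_pM// ler_norml; apply/andP; split.
    exact: cos_geN1.
  exact: cos_le1.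
rewrite normrM normr_sg mul1r normrM -[B]mul1r ler_pM// ler_norml.
by rewrite sin_geN1 sin_le1.
Qed.

Lemma coef_le m (i : path_index m) c s :
  `|coef i c s| <= weight i * (`|s| ^+ m / m`!%:R).
Proof.
elim: m i c s => [|m IH] i c s.
  rewrite expr0 fact0 divr1 mulr1 /=.
  apply: (le_trans (ler_normD _ _)).
  have Cs : `|cos (kap i ^+ 2 * s)| <= 1 by rewrite ler_norml cos_geN1 cos_le1.
  have Ss : `|sin (kap i ^+ 2 * s)| <= 1 by rewrite ler_norml sin_geN1 sin_le1.
  rewrite !normrM normr_sg mul1r.
  have := ler_wpM2r (normr_ge0 (u0 c i)) Cs.
  have := ler_wpM2r (normr_ge0 (u0 (~~ c) i)) Ss.
  by case: (c) => /=; lra.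
rewrite [weight _]/=.
set B : R := leRHS.
have -> : B = B / 2 + B / 2 by rewrite /B; lra.
rewrite /=; set l := (X in rotate X); set F := (X in duhamel_integrand _ X).
apply: normr_rotate_le => d.
have cF e : continuous (F e).
  by move=> x; apply: (der_continuous (derZ _ (coef_der _ _ _))).
have -> : B / 2 = `|b i.2.1| * weight i.1 * (`|s| ^+ m.+1 / m.+1`!%:R).
  by rewrite /B; lra.
apply: normr_primitive_le; first exact: duhamel_integrand_continuous.
move=> x; apply: (le_trans (ler_normD _ _)).
have Cs : `|cos (l * x)| <= 1 by rewrite ler_norml cos_geN1 cos_le1.
have Ss : `|sin (l * x)| <= 1 by rewrite ler_norml sin_geN1 sin_le1.
rewrite normrM normr_sg mul1r [`|cos _ * _|]normrM [`|sin _ * _|]normrM.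
have Fe e : `|F e x| <= `|b i.2.1| * weight i.1 * (`|x| ^+ m / m`!%:R) / 2.
  rewrite /F normrM normrM [`|2^-1|]ger0_norm ?invr_ge0//.
  by have := ler_wpM2l (normr_ge0 (b i.2.1)) (IH i.1 e x); lra.
have := ler_pM (normr_ge0 _) (normr_ge0 _) Cs (Fe (~~ d)).
have := ler_pM (normr_ge0 _) (normr_ge0 _) Ss (Fe d).
by lra.
Qed.

(** Each cosine of the potential extends a path in two ways: the growth is
    geometric, and the factorials of [coef_le] outweigh it. *)
Lemma sum_weight m :
  \sum_(i : path_index m) weight i =
  (4 * \sum_j `|b j|) ^+ m * \sum_i (`|u0 false i| + `|u0 true i|).
Proof.
elim: m => [|m IH]; first by rewrite expr0 mul1r.
rewrite exprS -mulrA -IH.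
rewrite -(pair_bigA _ (fun i (p : J * bool) => 2 * `|b p.1| * weight i))/=.
have -> : 4 * (\sum_j `|b j|) = \sum_(p : J * bool) 2 * `|b p.1|.
  rewrite -(pair_bigA _ (fun j (_ : bool) => 2 * `|b j|))/= mulr_sumr.
  by apply: eq_bigr => j _; rewrite big_bool/=; ring.
by rewrite [RHS]mulr_sumr; apply: eq_bigr => i _; rewrite mulr_suml.
Qed.

(** The summand [m] leaves room for the derivatives in time, see
    [forced_bound]. *)
Definition freq_bound m : R :=
  1 + \sum_i `|kap i| + m%:R * (1 + \sum_j `|om j|).

Lemma normr_le_sum (I : finType) (f : I -> R) i : `|f i| <= \sum_j `|f j|.
Proof. by rewrite (bigD1 i)//= lerDl sumr_ge0. Qed.

Lemma freq_bound_ge m (i : path_index m) : `|freq i| + m%:R + 1 <= freq_bound m.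
Proof.
rewrite /freq_bound; elim: m i => [|m IH] i.
  by rewrite /= mul0r !addr0 addrC lerD2l; exact: normr_le_sum.
have := IH i.1; rewrite /= -natr1.
have : `|freq i.1 + (if i.2.2 then om i.2.1 else - om i.2.1)| <=
    `|freq i.1| + `|om i.2.1|.
  by apply: (le_trans (ler_normD _ _)); case: ifP => _; rewrite ?normrN.
have := normr_le_sum om i.2.1.
by lra.
Qed.

Lemma freq_bound_ge1 m : 1 <= freq_bound m.
Proof.
rewrite /freq_bound -addrA lerDl addr_ge0 ?mulr_ge0 ?addr_ge0 ?sumr_ge0//.
Qed.

Lemma freq_bound_nd m : freq_bound m <= freq_bound m.+1.
Proof.
rewrite /freq_bound lerD2l ler_wpM2r ?addr_ge0 ?sumr_ge0// ler_nat.
by rewrite leqnSn.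
Qed.

Definition size_bound (S : R) m : R := S ^+ m / m`!%:R.

Lemma size_bound_ge0 S m : 0 <= S -> 0 <= size_bound S m.
Proof. by move=> S0; rewrite /size_bound divr_ge0// exprn_ge0. Qed.

Lemma size_boundS S m : 1 <= S ->
  size_bound S m <= m.+1%:R * size_bound S m.+1.
Proof.
move=> S1; rewrite /size_bound.
have -> : m.+1%:R * (S ^+ m.+1 / m.+1`!%:R) = S * (S ^+ m / m`!%:R).
  rewrite factS natrM exprS; field.
  by rewrite nat1r !pnatr_eq0 -lt0n fact_gt0.
by rewrite ler_peMl// divr_ge0// exprn_ge0// (le_trans _ S1).
Qed.

(** The two terms of the equation for a coefficient: the frequency squared and,
    through [S ^+ m / m!] being at most [m.+1] times its successor, the
    number of interactions, are both absorbed by the square of [freq_bound]. *)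
Lemma forced_bound m (i : path_index m) (S : R) (x y B : R) : 1 <= S ->
    `|x| <= B * (weight i * size_bound S m) ->
    `|y| <= m%:R * (B * (weight i * size_bound S m)) ->
  `|freq i ^+ 2 * x + y| <=
    freq_bound m ^+ 2 * B * (weight i * size_bound S m).
Proof.
move=> S1; set W := weight i * _ => xB yB.
have W0 : 0 <= B * W by apply: le_trans xB.
apply: (le_trans (ler_normD _ _)).
rewrite normrM -mulrA.
have := ler_wpM2l (normr_ge0 (freq i ^+ 2)) xB.
have h : `|freq i ^+ 2| + m%:R <= freq_bound m ^+ 2.
  rewrite normrX; have := freq_bound_ge i.
  have := normr_ge0 (freq i); move: `|freq i| => f f0 fb.
  have m0 : 0 <= m%:R :> R by [].
  apply: (@le_trans _ _ ((f + m%:R + 1) ^+ 2)); first by nra.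
  by rewrite lerXn2r// nnegrE; lra.
have := ler_wpM2r W0 h.
lra.
Qed.

Lemma interaction_bound m (p : path_index m.+1) (S : R) (x B : R) : 1 <= S ->
    0 <= B -> `|x| <= B * (weight p.1 * size_bound S m) ->
  `|b p.2.1 / 2 * x| <= m.+1%:R * (B * (weight p * size_bound S m.+1)).
Proof.
move=> S1 B0 xB; rewrite normrM normrM [`|2^-1|]ger0_norm ?invr_ge0//.
have w0 := weight_ge0 p.1.
have e0 : 0 <= size_bound S m.+1 by apply: size_bound_ge0; apply: le_trans S1.
have n0 : 0 <= m.+1%:R :> R by [].
move: xB (size_boundS m S1) => /=; move: (weight p.1) w0 (m.+1%:R) n0 => w w0 n n0.
move: (size_bound S m.+1) e0 (size_bound S m) => e' e0 e xB ee.
have h : `|x| <= B * (w * (n * e')).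
  by apply: (le_trans xB); rewrite !ler_wpM2l.
have := ler_wpM2l (normr_ge0 (b p.2.1)) h.
have : 0 <= `|b p.2.1| * (B * (w * (n * e'))) by rewrite !mulr_ge0.
by lra.
Qed.

Lemma coef_bound m (i : path_index m) c (s S : R) : 1 <= S -> `|s| <= S ->
  `|coef i c s| <= 1 * (weight i * size_bound S m).
Proof.
move=> S1 sS; rewrite mul1r; apply: le_trans (coef_le _ _ _) _.
rewrite ler_wpM2l ?weight_ge0// ler_wpM2r ?invr_ge0//.
by rewrite lerXn2r// nnegrE (le_trans _ S1).
Qed.

Lemma dcoef_bound m (i : path_index m) c (s S : R) : 1 <= S -> `|s| <= S ->
  `|dcoef i c s| <= freq_bound m ^+ 2 * 1 * (weight i * size_bound S m).
Proof.
move=> S1 sS; rewrite /dcoef normrM normr_sg mul1r; apply: forced_bound => //.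
  exact: coef_bound.
case: m i => [|m] i; first by rewrite mul0r normr0.
by apply: interaction_bound => //; exact: coef_bound.
Qed.

Lemma ddcoef_bound m (i : path_index m) c (s S : R) : 1 <= S -> `|s| <= S ->
  `|ddcoef i c s| <=
    freq_bound m ^+ 2 * (freq_bound m ^+ 2 * 1) * (weight i * size_bound S m).
Proof.
move=> S1 sS; rewrite /ddcoef normrM normr_sg mul1r; apply: forced_bound => //.
  exact: dcoef_bound.
case: m i => [|m] i; first by rewrite mul0r normr0.
have fb0 n : 0 <= freq_bound n by apply: le_trans (freq_bound_ge1 n).
apply: interaction_bound => //; first by rewrite mulr1 exprn_ge0.
apply: le_trans (dcoef_bound _ _ S1 sS) _.
apply: ler_wpM2r.
  by rewrite mulr_ge0 ?weight_ge0 ?size_bound_ge0 ?(le_trans _ S1).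
by rewrite !mulr1 lerXn2r// ?nnegrE// freq_bound_nd.
Qed.


Definition levelsum m (a : path_index m -> R) (h : R -> R) (x : R) : R :=
  \sum_i a i * h (freq i * x).

(** The fourth power of [freq_bound] allows for two derivatives in time, each
    worth two derivatives in space. *)
Definition majorant (S : R) m : R :=
  freq_bound m ^+ 4 * (\sum_(i : path_index m) weight i * size_bound S m).

Lemma majorant_cvg (S : R) : 1 <= S -> cvgn (series (majorant S)).
Proof.
move=> S1; have S0 : 0 <= S by apply: le_trans S1.
pose c0 : R := 2 + \sum_i `|kap i| + \sum_j `|om j|.
pose W0 : R := \sum_i (`|u0 false i| + `|u0 true i|).
pose X : R := 64 * (\sum_j `|b j|) * S.
have W00 : 0 <= W0 by rewrite sumr_ge0// => i _; rewrite addr_ge0.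
apply: (@dominated_cvg _ (exp_coeff X) _ (c0 ^+ 4 * W0)).
  exact: is_cvg_series_exp_coeff.
move=> m; rewrite ger0_norm; last first.
  rewrite /majorant mulr_ge0// ?exprn_ge0//.
    exact: le_trans (freq_bound_ge1 m).
  by rewrite sumr_ge0// => i _; rewrite mulr_ge0 ?weight_ge0 ?size_bound_ge0.
rewrite /majorant -mulr_suml sum_weight -/W0 /size_bound.
have fb : freq_bound m <= c0 * 2 ^+ m.
  have m2 : m%:R <= 2 ^+ m :> R.
    by rewrite -natrX ler_nat ltnW// ltn_expl.
  have o2 : 1 <= 2 ^+ m :> R by rewrite exprn_ege1// ler1n.
  have D0 : 0 <= \sum_i `|kap i| by rewrite sumr_ge0.
  have O0 : 0 <= \sum_j `|om j| by rewrite sumr_ge0.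
  rewrite /freq_bound /c0.
  have h1 := ler_wpM2r (addr_ge0 ler01 O0) m2.
  have h2 := ler_wpM2l (addr_ge0 ler01 D0) o2.
  lra.
have fb4 : freq_bound m ^+ 4 <= (c0 * 2 ^+ m) ^+ 4.
  by rewrite lerXn2r// nnegrE ?(le_trans _ fb)// (le_trans _ (freq_bound_ge1 m)).
apply: le_trans (ler_wpM2r _ fb4) _.
  rewrite !mulr_ge0 ?exprn_ge0 ?mulr_ge0 ?sumr_ge0//.
have p16 : (2 ^+ m) ^+ 4 = 16 ^+ m :> R.
  by rewrite -exprM mulnC exprM -natrX.
rewrite /exp_coeff /= /X (_ : 64 = 16 * 4); last by rewrite -natrM.
rewrite !exprMn p16 le_eqVlt; apply/orP; left; apply/eqP.
by move: (16 ^+ m) => Q; ring.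
Qed.

Lemma levelsum_bound m (a : path_index m -> R) (h : R -> R) x (B S : R) k :
    (k <= 4)%N -> 1 <= S ->
    (forall i, `|a i| <= freq_bound m ^+ k * (weight i * size_bound S m)) ->
    (forall y, `|h y| <= 1) ->
  `|levelsum a h x| <= majorant S m.
Proof.
move=> k4 S1 aB h1; have S0 : 0 <= S by apply: le_trans S1.
apply: (le_trans (ler_norm_sum _ _ _)); rewrite /majorant mulr_sumr.
apply: ler_sum => i _; rewrite normrM -[leRHS]mulr1 ler_pM//.
apply: (le_trans (aB i)); rewrite ler_wpM2r//.
  by rewrite mulr_ge0 ?weight_ge0 ?size_bound_ge0.
by rewrite ler_weXn2l// freq_bound_ge1.
Qed.

Lemma norm_sin_le1 (y : R) : `|sin y| <= 1.
Proof. by rewrite ler_norml sin_geN1 sin_le1. Qed.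

Lemma norm_cos_le1 (y : R) : `|cos y| <= 1.
Proof. by rewrite ler_norml cos_geN1 cos_le1. Qed.

Lemma freq_coef_bound m (i : path_index m) c (s S : R) k : 1 <= S -> `|s| <= S ->
  `|freq i ^+ k * coef i c s| <= freq_bound m ^+ k * (weight i * size_bound S m).
Proof.
move=> S1 sS; rewrite normrM normrX.
apply: ler_pM => //.
  have := freq_bound_ge i; have : 0 <= m%:R :> R by [].
  move=> ? ?; rewrite lerXn2r ?nnegrE//.
    by rewrite (le_trans _ (freq_bound_ge1 m)).
  by lra.
by have := coef_bound i c S1 sS; rewrite mul1r.
Qed.

(** The level [m] of the Dyson series and its derivatives. *)
Definition level c s x m := levelsum (fun i : path_index m => coef i c s) sin x.
Definition level_s c s x m := levelsum (fun i : path_index m => dcoef i c s) sin x.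
Definition level_ss c s x m := levelsum (fun i : path_index m => ddcoef i c s) sin x.
Definition level_x c s x m :=
  levelsum (fun i : path_index m => freq i ^+ 1 * coef i c s) cos x.
Definition level_xx c s x m :=
  levelsum (fun i : path_index m => - (freq i ^+ 2 * coef i c s)) sin x.
Definition level_xxx c s x m :=
  levelsum (fun i : path_index m => - (freq i ^+ 3 * coef i c s)) cos x.

Lemma level_bounds (s S : R) : 1 <= S -> `|s| <= S -> forall c x m,
  [/\ `|level c s x m| <= majorant S m, `|level_s c s x m| <= majorant S m
    & `|level_ss c s x m| <= majorant S m] /\
  [/\ `|level_x c s x m| <= majorant S m, `|level_xx c s x m| <= majorant S m
    & `|level_xxx c s x m| <= majorant S m].
Proof.
move=> S1 sS c x m; split; split.
- apply: (@levelsum_bound _ _ _ _ 0 _ 0) => // [i|y]; last exact: norm_sin_le1.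
  exact: coef_bound.
- apply: (@levelsum_bound _ _ _ _ 0 _ 2) => // [i|y]; last exact: norm_sin_le1.
  by have := dcoef_bound i c S1 sS; rewrite mulr1.
- apply: (@levelsum_bound _ _ _ _ 0 _ 4) => // [i|y]; last exact: norm_sin_le1.
  by have := ddcoef_bound i c S1 sS; rewrite mulr1 -exprD.
- apply: (@levelsum_bound _ _ _ _ 0 _ 1) => // [i|y]; last exact: norm_cos_le1.
  exact: freq_coef_bound.
- apply: (@levelsum_bound _ _ _ _ 0 _ 2) => // [i|y]; last exact: norm_sin_le1.
  by rewrite normrN; exact: freq_coef_bound.
- apply: (@levelsum_bound _ _ _ _ 0 _ 3) => // [i|y]; last exact: norm_cos_le1.
  by rewrite normrN; exact: freq_coef_bound.
Qed.

Lemma der_levelsum_x m (a : path_index m -> R) (h h' : R -> R) (x : R) :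
  (forall y : R, is_derive y 1 h (h' y)) ->
  is_derive x 1 (levelsum a h) (levelsum (fun i => freq i * a i) h' x).
Proof.
move=> hh'; apply: der_sum => i.
by apply: is_derive_eq (derZ (a i) (der_scaled (hh' (freq i * x)))) _; ring.
Qed.

Lemma level_der c m (s x : R) :
  [/\ is_derive s 1 (fun s => level c s x m) (level_s c s x m),
      is_derive s 1 (fun s => level_s c s x m) (level_ss c s x m),
      is_derive x 1 (fun x => level c s x m) (level_x c s x m),
      is_derive x 1 (fun x => level_x c s x m) (level_xx c s x m) &
      is_derive x 1 (fun x => level_xx c s x m) (level_xxx c s x m)].
Proof.
split.
- apply: der_sum => i.
  by apply: is_derive_eq (derM (coef_der i c s) (der_cst _ s)) _;
    rewrite mulr0 addr0.
- apply: der_sum => i.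
  by apply: is_derive_eq (derM (dcoef_der i c s) (der_cst _ s)) _;
    rewrite mulr0 addr0.
- have D := @der_levelsum_x m (fun i => coef i c s) sin cos x
    (fun y => is_derive_sin y).
  by apply: (is_derive_eq D); apply: eq_bigr => i _; rewrite expr1.
- have D := @der_levelsum_x m (fun i => freq i ^+ 1 * coef i c s) cos
    (fun y => - sin y) x (fun y => is_derive_cos y).
  by apply: (is_derive_eq D); apply: eq_bigr => i _; ring.
- have D := @der_levelsum_x m (fun i => - (freq i ^+ 2 * coef i c s)) sin cos x
    (fun y => is_derive_sin y).
  by apply: (is_derive_eq D); apply: eq_bigr => i _; ring.
Qed.

Lemma sin_freq m (i : path_index m) : sin (freq i) = 0.
Proof.
elim: m i => [|m IH] i /=; first exact: sin_kap.
by case: ifP => _; rewrite sinD IH mul0r add0r ?sinN sin_om ?oppr0 mulr0.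
Qed.

Lemma level_boundary c s m : level c s 0 m = 0 /\ level c s 1 m = 0.
Proof.
split; apply: big1 => i _; first by rewrite mulr0 sin0 mulr0.
by rewrite mulr1 sin_freq mulr0.
Qed.

Lemma level_initial c x m :
  level c 0 x m = if m is 0 then \sum_i u0 c i * sin (kap i * x) else 0.
Proof.
case: m => [|m].
  by apply: eq_bigr => i _; rewrite /= /rotate mulr0 cos0 sin0; ring.
apply: big1 => i _; have := coef_le i c 0.
rewrite normr0 expr0n/= mul0r mulr0 normr_le0 => /eqP.
by rewrite /= => ->; rewrite mul0r.
Qed.

(** Multiplication by a cosine of frequency [om j] shifts the frequency of a
    sine by [om j] in both directions: this is what the successive steps of
    a path record. *)
Lemma level_equation c s x m :
  level_s c s x m = sg c * (-1 * level_xx (~~ c) s x m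
                        + cossum x * shiftr (level (~~ c) s x) m).
Proof.
have split_dcoef : level_s c s x m = sg c * (-1 * level_xx (~~ c) s x m
    + levelsum (fun i : path_index m => coef_force i (~~ c) s) sin x).
  rewrite /level_s /level_xx /levelsum !mulr_sumr -big_split mulr_sumr/=.
  by apply: eq_bigr => i _; rewrite /dcoef; ring.
rewrite split_dcoef; congr (_ * (_ + _)).
case: m {split_dcoef} => [|m].
  by rewrite mulr0; apply: big1 => i _; rewrite mul0r.
rewrite /levelsum /= -(pair_bigA _ (fun i (p : J * bool) =>
  b p.1 / 2 * coef i (~~ c) s *
  sin ((freq i + (if p.2 then om p.1 else - om p.1)) * x)))/=.
rewrite /level /levelsum mulr_sumr; apply: eq_bigr => i _.
rewrite -(pair_bigA _ (fun j (e : bool) =>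
  b j / 2 * coef i (~~ c) s *
  sin ((freq i + (if e then om j else - om j)) * x)))/=.
rewrite /cossum mulr_suml; apply: eq_bigr => j _.
rewrite big_bool/= !mulrDl mulNr sinD sinB.
by field.
Qed.

Lemma level_cvg c s x :
  [/\ cvgn (series (level c s x)), cvgn (series (level_s c s x)),
      cvgn (series (level_x c s x)), cvgn (series (level_xx c s x)) &
      cvgn (series (level_xxx c s x))].
Proof.
pose S : R := `|s| + 1.
have S1 : 1 <= S by rewrite lerDr.
have sS : `|s| <= S by rewrite lerDl.
have B m := level_bounds S1 sS c x m.
by split; apply: (@dominated_cvg _ _ _ 1 (majorant_cvg S1)) => m;
  rewrite mul1r; case: (B m) => -[? ? ?] [].
Qed.

(** The finite levels of the Dyson series are summed with two derivatives in
    each variable: the majorants of the levels bound Taylor remainders too. *)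
Lemma sum_taylor (f g h : R -> R^nat) (M : R^nat) (x y : R) :
    cvgn (series M) ->
    (forall z, cvgn (series (f z)) /\ cvgn (series (g z))) ->
    (forall m (z : R), is_derive z 1 (fun z => f z m) (g z m)) ->
    (forall m (z : R), is_derive z 1 (fun z => g z m) (h z m)) ->
    (forall m z, (x <= z <= y) || (y <= z <= x) -> `|h z m| <= M m) ->
  `|sumr (f y) - sumr (f x) - (y - x) * sumr (g x)| <=
    sumr M * (y - x) ^+ 2.
Proof.
move=> cM cfg fg gh hM; have [cfx cgx] := cfg x; have [cfy _] := cfg y.
have -> : sumr (f y) - sumr (f x) - (y - x) * sumr (g x) =
    sumr (fun m => f y m + (-1 * f x m + - (y - x) * g x m)).
  rewrite !sumrD ?sumrZ//; first by ring.
  - exact: is_cvg_seriesZr.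
  - exact: is_cvg_seriesZr.
  - by apply: is_cvg_seriesDr; exact: is_cvg_seriesZr.
rewrite [leRHS]mulrC; apply: normr_sumr_le => // m.
have -> : f y m + (-1 * f x m + - (y - x) * g x m) =
    f y m - f x m - (y - x) * g x m by ring.
rewrite [leRHS]mulrC.
by apply: (@normr_taylor2 _ (fun z => f z m) (fun z => g z m)
  (fun z => h z m)) => // z; exact: hM.
Qed.

(** The sum of the Dyson series and its derivatives. *)
Definition dyson c s x := sumr (level c s x).
Definition dyson_s c s x := sumr (level_s c s x).
Definition dyson_x c s x := sumr (level_x c s x).
Definition dyson_xx c s x := sumr (level_xx c s x).

Lemma dyson_equation c s x :
  dyson_s c s x = sg c * (- dyson_xx (~~ c) s x + cossum x * dyson (~~ c) s x).
Proof.
have [cU _ _ cUxx _] := level_cvg (~~ c) s x.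
have [cS SE] := sumr_shift cU.
rewrite /dyson_s /dyson_xx /dyson -SE -[- sumr _]mulN1r -(sumrZ (-1))//
  -(sumrZ (cossum x))//.
rewrite -sumrD; [|exact: is_cvg_seriesZr..].
rewrite -sumrZ; last by apply: is_cvg_seriesDr; exact: is_cvg_seriesZr.
by congr sumr; apply/funext => m; exact: level_equation.
Qed.

Lemma dyson_initial c x : dyson c 0 x = \sum_i u0 c i * sin (kap i * x).
Proof.
have H n : series (level c 0 x) n.+1 = \sum_i u0 c i * sin (kap i * x).
  rewrite /series/= big_nat_recl// big1_seq => [|m _]; last first.
    by rewrite level_initial.
  by rewrite addr0 level_initial.
rewrite /dyson /sumr; apply/cvg_lim => //; rewrite -cvg_shiftS.
by under eq_fun do rewrite H; exact: cvg_cst.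
Qed.

Lemma dyson_boundary c s : dyson c s 0 = 0 /\ dyson c s 1 = 0.
Proof.
have sum0 f : (forall m, f m = 0) -> sumr f = 0 :> R.
  move=> f0; rewrite /sumr (_ : series f = fun=> 0) ?lim_cst//.
  by apply/funext => n; rewrite /series/= big1.
by split; apply: sum0 => m; have [] := level_boundary c s m.
Qed.

Lemma dyson_der_x c s (x : R) :
  is_derive x 1 (dyson c s) (dyson_x c s x) /\
  is_derive x 1 (dyson_x c s) (dyson_xx c s x).
Proof.
pose S : R := `|s| + 1.
have S1 : 1 <= S by rewrite lerDr.
have sS : `|s| <= S by rewrite lerDl.
split; apply: (@der_of_quadratic _ _ _ (sumr (majorant S))) => y _.
- apply: (@sum_taylor (level c s) (level_x c s) (level_xx c s)) => [|z|m z|m z|m z _].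
  + exact: majorant_cvg.
  + by have [] := level_cvg c s z.
  + by have [] := level_der c m s z.
  + by have [] := level_der c m s z.
  + by have [_ []] := level_bounds S1 sS c z m.
- apply: (@sum_taylor (level_x c s) (level_xx c s) (level_xxx c s)) => [|z|m z|m z|m z _].
  + exact: majorant_cvg.
  + by have [] := level_cvg c s z.
  + by have [] := level_der c m s z.
  + by have [] := level_der c m s z.
  + by have [_ []] := level_bounds S1 sS c z m.
Qed.

Lemma dyson_xx_continuous c s : continuous (dyson_xx c s).
Proof.
pose S : R := `|s| + 1.
have S1 : 1 <= S by rewrite lerDr.
have sS : `|s| <= S by rewrite lerDl.
pose L := sumr (majorant S).
have L0 : 0 <= L.
  rewrite -[L]mul1r; apply: le_trans (normr_ge0 (dyson_xx c s 0)) _.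
  apply: normr_sumr_le; first exact: majorant_cvg.
  by move=> m; rewrite mul1r; have [_ []] := level_bounds S1 sS c 0 m.
have lip x y : `|dyson_xx c s y - dyson_xx c s x| <= `|y - x| * L.
  have [_ _ _ cx _] := level_cvg c s x; have [_ _ _ cy _] := level_cvg c s y.
  rewrite /dyson_xx -mulN1r -sumrZ// -sumrD//; last exact: is_cvg_seriesZr.
  apply: normr_sumr_le => [|m]; first exact: majorant_cvg.
  rewrite mulN1r [leRHS]mulrC.
  apply: (@normr_lipschitz _ (fun x => level_xx c s x m) (fun x => level_xxx c s x m)).
    by move=> z _; have [] := level_der c m s z.
  by move=> z _; have [_ []] := level_bounds S1 sS c z m.
move=> x; apply/cvgrPdist_le => e e0; near=> y.
rewrite distrC; apply: le_trans (lip _ _) _.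
apply: (@le_trans _ _ (e / (L + 1) * L)).
  rewrite ler_wpM2r// distrC; near: y; apply: cvgr_dist_le; first exact: cvg_id.
  by rewrite divr_gt0// ltr_wpDl.
by rewrite mulrAC ler_pdivrMr ?ltr_wpDl// ler_wpM2l ?(ltW e0)// lerDl.
Unshelve. all: by end_near. Qed.

Lemma dyson_bounds (S : R) : exists C : R, forall c r s x, `|r| <= S -> `|s| <= S ->
  [/\ `|dyson c s x| <= C, `|dyson_s c s x| <= C, `|dyson_xx c s x| <= C &
      `|dyson c r x - dyson c s x - (r - s) * dyson_s c s x| <= C * (r - s) ^+ 2].
Proof.
pose S' : R := `|S| + 1.
have S1 : 1 <= S' by rewrite lerDr.
have SS' z : `|z| <= S -> `|z| <= S'.
  by move=> zS; rewrite /S'; have := ler_norm S; lra.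
exists (sumr (majorant S')) => c r s x /SS' rS /SS' sS.
have cM := majorant_cvg S1.
have B m := level_bounds S1 sS c x m.
split.
- rewrite -[leRHS]mul1r; apply: normr_sumr_le => // m.
  by rewrite mul1r; case: (B m) => -[].
- rewrite -[leRHS]mul1r; apply: normr_sumr_le => // m.
  by rewrite mul1r; case: (B m) => -[].
- rewrite -[leRHS]mul1r; apply: normr_sumr_le => // m.
  by rewrite mul1r; case: (B m) => _ [].
- apply: (@sum_taylor (fun s => level c s x) (fun s => level_s c s x)
    (fun s => level_ss c s x)) => // [z|m z|m z|m z zrs].
  + by have [] := level_cvg c z x.
  + by have [] := level_der c m z x.
  + by have [] := level_der c m z x.
  + have zS : `|z| <= S'.
      by move: rS sS; rewrite !ler_norml; move: zrs; lra.
    by have [[]] := level_bounds S1 zS c x m.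
Qed.

(** The bounds are uniform in [x] and locally uniform in time, so that derivatives
    in time also hold for the [L^2] norm. *)
Lemma schrodinger_group : exists v vs vxx : bool -> R -> R -> R,
  [/\ forall c s x,
        vs c s x = sg c * (- vxx (~~ c) s x + cossum x * v (~~ c) s x),
      forall c x, v c 0 x = \sum_i u0 c i * sin (kap i * x),
      forall c s, v c s 0 = 0 /\ v c s 1 = 0,
      forall c s, exists vx : R -> R,
        [/\ forall x : R, is_derive x 1 (v c s) (vx x),
            forall x : R, is_derive x 1 vx (vxx c s x) &
            continuous (vxx c s)] &
      forall S : R, exists C : R, forall c r s x, `|r| <= S -> `|s| <= S ->
        [/\ `|v c s x| <= C, `|vs c s x| <= C, `|vxx c s x| <= C &
            `|v c r x - v c s x - (r - s) * vs c s x| <= C * (r - s) ^+ 2]].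
Proof.
exists dyson, dyson_s, dyson_xx; split.
- exact: dyson_equation.
- exact: dyson_initial.
- exact: dyson_boundary.
- move=> c s; exists (dyson_x c s); split.
  + by move=> x; have [] := dyson_der_x c s x.
  + by move=> x; have [] := dyson_der_x c s x.
  + exact: dyson_xx_continuous.
- exact: dyson_bounds.
Qed.

End Dyson.

(** * Solutions for smooth coefficients *)

Section Norms.
Context {R : realType}.
Local Notation mu := (@lebesgue_measure R).
Local Notation I01 := (`]0, 1[%classic : set R).

Lemma normc_le (z : R[i]) (B : R) : `|complex.Re z| <= B -> `|complex.Im z| <= B ->
  ComplexField.Normc.normc z <= 2 * B.
Proof.
case: z => x y /= xB yB.
have B0 : 0 <= B by apply: le_trans xB.
rewrite -[2 * B]ger0_norm ?mulr_ge0// -sqrtr_sqr ler_wsqrtr//.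
have := lerXn2r 2 (normr_ge0 x) (le_trans (normr_ge0 x) xB) xB.
have := lerXn2r 2 (normr_ge0 y) (le_trans (normr_ge0 y) yB) yB.
rewrite !real_normK ?num_real//.
have := sqr_ge0 B; rewrite exprMn; lra.
Qed.

Lemma L2_norm_le (f : R -> R[i]) (B : R) :
    measurable_fun I01 (rpart f) -> measurable_fun I01 (ipart f) ->
    (forall x, I01 x -> `|rpart f x| <= B) ->
    (forall x, I01 x -> `|ipart f x| <= B) ->
  (L2_norm f <= (2 * B)%:E)%E.
Proof.
move=> mr mi rB iB.
have B0 : 0 <= B.
  apply: le_trans (rB 2^-1 _); first exact: normr_ge0.
  by rewrite /= in_itv/=; lra.
have mI : measurable I01 by exact: measurable_itv.
pose g x := ComplexField.Normc.normc (f x).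
have mN : measurable_fun I01 g.
  rewrite (_ : g = fun x => Num.sqrt (rpart f x ^+ 2 + ipart f x ^+ 2)); last first.
    by apply/funext => x; rewrite /g /rpart /ipart; case: (f x).
  apply: (@measurableT_comp _ _ _ _ _ _ (@Num.sqrt R)).
    by apply: continuous_measurable_fun; exact: sqrt_continuous.
  by apply: measurable_funD; exact: measurable_funX.
rewrite /L2_norm unlock.
rewrite -/g.
have gB x : I01 x -> `|g x| <= 2 * B.
  move=> Ix; rewrite ger0_norm; first by apply: normc_le; [exact: rB|exact: iB].
  by rewrite /g; case: (f x) => a b; exact: sqrtr_ge0.
have -> : (\int[mu]_x (`|(EFin \o (g \_ I01)) x| `^ 2) =
    \int[mu]_(x in I01) (`|g x| `^ 2)%:E)%E.
  rewrite [RHS]integral_mkcond; apply: eq_integral => x _ /=.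
  rewrite !patchE; case: ifP => // _; by rewrite normr0 powR0.
have I2 : (\int[mu]_(x in I01) (`|g x| `^ 2)%:E <= ((2 * B) `^ 2)%:E)%E.
  apply: (@le_trans _ _ (\int[mu]_(x in I01) (cst ((2 * B) `^ 2)%:E x))%E).
    apply: ge0_le_integral.
    - exact: mI.
    - by move=> x _; rewrite lee_fin powR_ge0.
    - apply/measurable_EFinP; apply: (@measurableT_comp _ _ _ _ _ _
        (fun y : R => y `^ 2)).
        exact: measurable_powR.
      exact: measurableT_comp.
    - exact: measurable_cst.
    - move=> x Ix; rewrite lee_fin ge0_ler_powR ?nnegrE ?gB//.
      by rewrite mulr_ge0.
  have mu1 : mu I01 = 1%E.
    by rewrite /= lebesgue_measure_itv/= lte01 oppr0 adde0.
  by rewrite integral_cst// -[leRHS]mule1 -mu1.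
apply: (@le_trans _ _ ((((2 * B) `^ 2)%:E) `^ 2^-1)%E).
  apply: gt0_ler_poweR => //; rewrite ?in_itv/= ?leey ?andbT//.
    by apply: integral_ge0 => x _; rewrite lee_fin powR_ge0.
  by rewrite lee_fin powR_ge0.
rewrite poweR_EFin -powRrM mulfV// powRr1// mulr_ge0//.
Qed.

Lemma Linfty_norm_le (X : set R) (f : R -> R) (B : R) : 0 <= B ->
  (forall x, X x -> `|f x| <= B) -> (Linfty_norm X f <= B%:E)%E.
Proof.
move=> B0 fB; rewrite /Linfty_norm unlock; case: ifP => _; last by rewrite lee_fin.
apply/ess_supP; apply: aeW => x /=; rewrite lee_fin patchE.
by case: ifP => [|_]; [rewrite inE; exact: fB|rewrite normr0].
Qed.

Lemma continuous_in_L2 (f g : R -> R) (B : R) : continuous f -> continuous g ->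
    (forall x, I01 x -> `|f x| <= B) -> (forall x, I01 x -> `|g x| <= B) ->
  let h x := (f x +i* g x)%C in in_L2 h /\ (L2_norm h <= (2 * B)%:E)%E.
Proof.
move=> cf cg fB gB h.
have mf : measurable_fun I01 (rpart h).
  by apply: measurable_funTS; apply: continuous_measurable_fun.
have mg : measurable_fun I01 (ipart h).
  by apply: measurable_funTS; apply: continuous_measurable_fun.
have hB : (L2_norm h <= (2 * B)%:E)%E by exact: L2_norm_le.
by split=> //; split=> //; apply: le_lt_trans hB _; rewrite ltry.
Qed.

End Norms.


Section SmoothPotentials.
Context {R : realType}.
Local Notation I01 := (`]0, 1[%classic : set R).

Definition sin_sum (f : R -> R) : Prop := exists (K : finType) (c kap : K -> R),
  (forall k, sin (kap k) = 0) /\ f = fun x => \sum_k c k * sin (kap k * x).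

(** The product with [sin (pi * x)] satisfies the Dirichlet conditions, and
    product-to-sum formulas give it the form used for initial data. *)
Lemma sin_cos_sum (p : R -> R) : cos_sum 1 p ->
  sin_sum (fun x => sin (pi * x) * p x).
Proof.
move=> [J [b [om [om1 ->]]]].
exists ('I_J * bool)%type, (fun k => b k.1 / 2),
  (fun k => pi + (if k.2 then om k.1 else - om k.1)); split.
  move=> [j e] /=; have := om1 j; rewrite mulr1 => omj.
  by rewrite sinD sinpi mul0r add0r; case: e; rewrite ?sinN omj ?oppr0 mulr0.
apply/funext => x.
rewrite -(pair_bigA _ (fun j (e : bool) => b j / 2 *
  sin ((pi + (if e then om j else - om j)) * x)))/= mulr_sumr.
apply: eq_bigr => j _; rewrite big_bool/=; move: (@pi R) => P.
by rewrite !mulrDl mulNr sinD sinB; field.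
Qed.

Lemma sin_sum_smooth (f : R -> R) : sin_sum f -> smooth f.
Proof.
move=> [K [c [kap [_ ->]]]].
rewrite (_ : (fun x => _) = fun x => \sum_(i < #|K|) c (enum_val i) *
    sin (kap (enum_val i) * x)); last first.
  by apply/funext => x; rewrite (reindex _ (onW_bij _ (@enum_val_bij K))).
by apply: smooth_sum => k; exact: smooth_sin.
Qed.

(** [f phi' - f' phi] is an antiderivative of [f phi'' - f'' phi] that vanishes at
    both end points. *)
Lemma weak_derivative2_der (f fx fxx : R -> R) (phi : R -> R) :
    (forall x : R, is_derive x 1 f (fx x)) ->
    (forall x : R, is_derive x 1 fx (fxx x)) -> continuous fxx ->
    test_function I01 phi ->
  distr_of I01 f (derive1n 2 phi) = distr_of I01 fxx phi.
Proof.
move=> df dfx cfxx tphi; have [sphi _ _] := (test_functionE _ _).1 tphi.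
have phi0 : vanishes_off 0 1 phi.
  by apply: (test_function_vanishes _ tphi); exact: subset_itv_oo_cc.
have [p0 p1] := smooth_vanishing_ends sphi phi0.
have [dp0 dp1] := smooth_vanishing_ends (smooth_derive1 sphi)
  (vanishes_off_derive1 phi0).
have cg : continuous (fun x => f x * derive1n 2 phi x).
  move=> x; apply: cvgM; first exact: der_continuous (df x).
  exact: smooth_continuous.
have [G [_ dG]] := antiderivative_exists cg.
pose H x := f x * derive1 phi x - fx x * phi x.
have dH (x : R) : is_derive x 1 H (f x * derive1n 2 phi x - fxx x * phi x).
  apply: is_derive_eq (derB (derM (df x) (smooth_der sphi 1 x))
    (derM (dfx x) (smooth_der sphi 0 x))) _.
  by rewrite /derive1n/=; ring.
have dGH (x : R) : is_derive x 1 (fun x => G x - H x) (fxx x * phi x).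
  by apply: is_derive_eq (derB (dG x) (dH x)) _; ring.
have X01 : I01 = `]0, 1[%classic \/ I01 = `[0, 1]%classic by left.
rewrite /distr_of (Rintegral_der ltr01 X01 cg dG) (Rintegral_der ltr01 X01 _ dGH).
  by rewrite /H p0 p1 dp0 dp1 !mulr0 !subr0.
move=> x; apply: cvgM; first exact: cfxx.
exact: (smooth_continuous (n := 0) sphi).
Qed.

Lemma cvge0_squeeze (F : set_system R) {FF : Filter F} (t D : R)
    (h : R -> \bar R) : `|s - t| @[s --> F] --> (0 : R) ->
  (\forall s \near F, (0 <= h s <= (D * `|s - t|)%:E)%E) ->
  h s @[s --> F] --> 0%E.
Proof.
move=> st hD; apply: (squeeze_cvge hD); first exact: cvg_cst.
apply: cvg_EFin; first exact: nearW.
have : D * `|s - t| @[s --> F] --> D * 0 by apply: cvgM => //; exact: cvg_cst.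
by rewrite mulr0.
Qed.

(** Since the operator [- d^2/dx^2 + q] does not depend on time, the solution is
    the Schroedinger group at time [A t], where [A] is the antiderivative of
    [a] with [A 0 = 0]. The quadratic remainder of the group in time gives
    the limits in [L^2] with a linear rate. *)
Lemma regular_solution (T : R) (a q f g : R -> R) : 0 < T ->
    smooth a -> cos_sum 1 q -> sin_sum f -> sin_sum g ->
  exists (u ut : R -> R -> R[i]) (C : R),
    schrodinger_solution T a q (fun x => (f x +i* g x)%C) u ut /\
    forall t, 0 <= t <= T ->
      (L2_norm (u t) <= C%:E)%E /\ (L2_norm (ut t) <= C%:E)%E.
Proof.
move=> T0 sa [J [b [om [om1 ->]]]] [K1 [c1 [kap1 [k1 ->]]]]
  [K2 [c2 [kap2 [k2 ->]]]].
have om0 j : sin (om j) = 0 by have := om1 j; rewrite mulr1.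
pose kap (i : K1 + K2) := match i with inl i => kap1 i | inr i => kap2 i end.
have kap0 i : sin (kap i) = 0 by case: i.
pose u0 (c : bool) (i : K1 + K2) :=
  match i with inl i => if c then 0 else c1 i | inr i => if c then c2 i else 0 end.
have [v [vs [vxx [veq vini vbd vder vC]]]] := schrodinger_group u0 b kap0 om0.
have [A [A0 dA]] := antiderivative_exists (smooth_continuous (n := 0) sa).
have cA : continuous A by move=> s; exact: der_continuous (dA s).
have [S S0 AS] := continuous_bounded_itv 0 T cA.
have [B0 B00 aB0] := continuous_bounded_itv 0 T (smooth_continuous (n := 0) sa).
have [B1 B10 aB1] := continuous_bounded_itv 0 T (smooth_continuous (n := 1) sa).
have [C HC] := vC S.
have C0 : 0 <= C.
  have S00 : `|0 : R| <= S by rewrite normr0.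
  by have [h _ _ _] := HC true 0 0 0 S00 S00; apply: le_trans h.
have cv c s : continuous (v c s).
  by move=> x; have [vx [dvx _ _]] := vder c s; exact: der_continuous (dvx x).
have cvxx c s : continuous (vxx c s) by have [vx []] := vder c s.
have cvs c s : continuous (vs c s).
  move=> x; rewrite (_ : vs c s = fun x =>
    sg c * (- vxx (~~ c) s x + cossum om b x * v (~~ c) s x)); last first.
    by apply/funext => y; exact: veq.
  apply: cvgM; first exact: cvg_cst.
  apply: cvgD; first by apply: cvgN; exact: cvxx.
  apply: cvgM; last exact: cv.
  apply: cvg_sum_ord => j; apply: cvgM; first exact: cvg_cst.
  exact: (smooth_continuous (n := 0) (smooth_cos (w := om j))).
pose u t x := (v false (A t) x +i* v true (A t) x)%C.
pose ut t x := (a t * vs false (A t) x +i* (a t * vs true (A t) x))%C.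
pose uxx t x := (vxx false (A t) x +i* vxx true (A t) x)%C.
have bnd c t x : 0 <= t <= T ->
    [/\ `|v c (A t) x| <= C, `|vs c (A t) x| <= C & `|vxx c (A t) x| <= C].
  by move=> tT; have [] := HC c (A t) (A t) x (AS t tT) (AS t tT).
have uL2 t : 0 <= t <= T -> in_L2 (u t) /\ (L2_norm (u t) <= (2 * C)%:E)%E.
  move=> tT; have h c x : I01 x -> `|v c (A t) x| <= C.
    by move=> _; have [] := bnd c t x tT.
  exact: (continuous_in_L2 (cv false (A t)) (cv true (A t)) (h false) (h true)).
have uxxL2 t : 0 <= t <= T -> in_L2 (uxx t).
  move=> tT; have h c x : I01 x -> `|vxx c (A t) x| <= C.
    by move=> _; have [] := bnd c t x tT.
  by have [] := continuous_in_L2 (cvxx false (A t)) (cvxx true (A t))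
    (h false) (h true).
have utL2 t : 0 <= t <= T ->
    in_L2 (ut t) /\ (L2_norm (ut t) <= (2 * (B0 * C))%:E)%E.
  move=> tT; have h c x : I01 x -> `|a t * vs c (A t) x| <= B0 * C.
    move=> _; have [_ h _] := bnd c t x tT.
    by rewrite normrM ler_pM// aB0.
  have ch c : continuous (fun x => a t * vs c (A t) x).
    by move=> x; apply: cvgM; [exact: cvg_cst|exact: cvs].
  exact: (continuous_in_L2 (ch false) (ch true) (h false) (h true)).
have ALip s t : 0 <= s <= T -> 0 <= t <= T -> `|A s - A t| <= B0 * `|s - t|.
  move=> sT tT; apply: (normr_lipschitz (fun x _ => dA x)) => x xst.
  by apply: aB0; move: sT tT xst; lra.
pose D1 := C * B0 * (1 + 2 * S).
have vLip c s t x : 0 <= s <= T -> 0 <= t <= T ->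
    `|v c (A s) x - v c (A t) x| <= D1 * `|s - t|.
  move=> sT tT; have [_ hs _ hv] := HC c (A s) (A t) x (AS s sT) (AS t tT).
  have AL := ALip s t sT tT.
  have A2 : `|A s - A t| <= 2 * S.
    apply: le_trans (ler_normB _ _) _; have := AS s sT; have := AS t tT; lra.
  have h1 : `|(A s - A t) * vs c (A t) x| <= (B0 * `|s - t|) * C.
    by rewrite normrM ler_pM.
  have h2 : C * (A s - A t) ^+ 2 <= C * ((2 * S) * (B0 * `|s - t|)).
    by rewrite ler_wpM2l// -real_normK ?num_real// expr2 ler_pM.
  have -> : v c (A s) x - v c (A t) x =
    (v c (A s) x - v c (A t) x - (A s - A t) * vs c (A t) x)
    + (A s - A t) * vs c (A t) x by rewrite subrK.
  apply: le_trans (ler_normD _ _) _; rewrite /D1; lra.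
pose D2 := C * B0 ^+ 2 + B1 * C.
have vder2 c s t x : 0 <= s <= T -> 0 <= t <= T -> s != t ->
    `|(s - t)^-1 * (v c (A s) x - v c (A t) x) - a t * vs c (A t) x|
      <= D2 * `|s - t|.
  move=> sT tT st; have [_ hs _ hv] := HC c (A s) (A t) x (AS s sT) (AS t tT).
  have AL := ALip s t sT tT.
  have AT : `|A s - A t - (s - t) * a t| <= B1 * (s - t) ^+ 2.
    apply: (normr_taylor2 (fun x _ => dA x)
      (fun x _ => smooth_der sa 0 x)) => z zst.
    by apply: aB1; move: sT tT zst; lra.
  have st0 : s - t != 0 by rewrite subr_eq0.
  have -> : (s - t)^-1 * (v c (A s) x - v c (A t) x) - a t * vs c (A t) x =
      (s - t)^-1 * ((v c (A s) x - v c (A t) x - (A s - A t) * vs c (A t) x)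
        + (A s - A t - (s - t) * a t) * vs c (A t) x) by field.
  rewrite normrM normfV ler_pdivrMl ?normr_gt0//.
  apply: le_trans (ler_normD _ _) _.
  have h1 : `|(A s - A t - (s - t) * a t) * vs c (A t) x| <=
      (B1 * (s - t) ^+ 2) * C by rewrite normrM ler_pM.
  have h2 : C * (A s - A t) ^+ 2 <= C * (B0 ^+ 2 * (s - t) ^+ 2).
    rewrite ler_wpM2l// -exprMn -real_normK ?num_real// -[leRHS]real_normK ?num_real//.
    rewrite lerXn2r ?nnegrE//; apply: (le_trans AL).
    by rewrite normrM (ger0_norm B00).
  rewrite mulrCA -expr2 real_normK ?num_real// /D2; lra.
have st0 t : `|s - t| @[s --> t] --> (0 : R).
  have : `|s - t| @[s --> t] --> `|t - t|.
    by apply: cvg_norm; apply: cvgB; [exact: cvg_id|exact: cvg_cst].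
  by rewrite subrr normr0.
exists u, ut, (Num.max (2 * C) (2 * (B0 * C))); split; last first.
  move=> t tT; have [_ h1] := uL2 t tT; have [_ h2] := utL2 t tT.
  by split; [apply: le_trans h1 _|apply: le_trans h2 _];
    rewrite lee_fin le_max lexx ?orbT.
split.
- move=> t tT; split; first by have [] := uL2 t tT.
  apply: (@cvge0_squeeze _ _ t (2 * D1)).
    by apply: cvg_within_filter; exact: st0.
  have : \forall s \near nbhs t, `[0, T]%classic s ->
      (0 <= L2_norm (fun x => u s x - u t x)%R <= (2 * D1 * `|s - t|)%:E)%E.
    apply: nearW => s; rewrite /= in_itv/= => sT.
    rewrite Lnorm_ge0/= -mulrA.
    pose h c x := v c (A s) x - v c (A t) x.
    have ch c : continuous (h c).
      by move=> x; apply: cvgB; exact: cv.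
    have [_] := continuous_in_L2 (ch false) (ch true)
      (fun x _ => vLip false s t x sT tT) (fun x _ => vLip true s t x sT tT).
    by [].
  by [].
- move=> t tT; split; first by have [] := utL2 t tT.
  apply: (@cvge0_squeeze _ _ t (2 * D2)).
    apply: cvg_within_filter; apply: cvg_within_filter; exact: st0.
  have : \forall s \near nbhs t, s != t -> `[0, T]%classic s ->
      (0 <= L2_norm (fun x => ((s - t)^-1)%:C%C * (u s x - u t x) - ut t x)%R
         <= (2 * D2 * `|s - t|)%:E)%E.
    apply: nearW => s st; rewrite /= in_itv/= => sT.
    rewrite Lnorm_ge0/= -mulrA.
    pose h c x := (s - t)^-1 * (v c (A s) x - v c (A t) x) - a t * vs c (A t) x.
    have ch c : continuous (h c).
      move=> x; apply: cvgB; (apply: cvgM; first exact: cvg_cst).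
        by apply: cvgB; exact: cv.
      exact: cvs.
    have [_] := continuous_in_L2 (ch false) (ch true)
      (fun x _ => vder2 false s t x sT tT st) (fun x _ => vder2 true s t x sT tT st).
    rewrite (_ : (fun x => (h false x +i* h true x)%C) =
      fun x => ((s - t)^-1)%:C%C * (u s x - u t x) - ut t x)//.
    apply/funext => x; apply/eqP; rewrite eq_complex /= /h.
    by rewrite !mul0r subr0 addr0 !eqxx.
  by [].
- move=> t tT; exists (uxx t); split; first exact: uxxL2.
    move=> phi tphi; split.
      have [vx [d1 d2 cxx]] := vder false (A t).
      exact: (weak_derivative2_der d1 d2 cxx tphi).
    have [vx [d1 d2 cxx]] := vder true (A t).
    exact: (weak_derivative2_der d1 d2 cxx tphi).
  apply: aeW => x /= _; apply/eqP; rewrite eq_complex /=.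
  have e1 := veq true (A t) x; have e2 := veq false (A t) x.
  rewrite /sg/= in e1 e2; rewrite e1 e2 /cossum.
  by apply/andP; split; apply/eqP; ring.
- move=> x _; rewrite /u A0 !vini; congr (_ +i* _)%C.
    rewrite big_sumType/= [X in _ + X]big1 ?addr0// => i _; exact: mul0r.
  by rewrite big_sumType/= big1 ?add0r// => i _; exact: mul0r.
- move=> t tT; split.
  + exact: continuous_subspaceT (cv false (A t)).
  + exact: continuous_subspaceT (cv true (A t)).
  + by rewrite /u (vbd false _).1 (vbd true _).1.
  + by rewrite /u (vbd false _).2 (vbd true _).2.
Qed.

End SmoothPotentials.

(** * Very weak solutions *)

Section Slowdown.
Context {R : realType}.

(** [nu eps] is the largest [n] for which an increasing majorant [B] of [b] has
    [B n <= B 0 / eps]; it tends to infinity because every [B n] is finite. *)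
Lemma slow_reindexing (b : nat -> R) : exists (C : R) (nu : R -> nat),
  [/\ 0 < C, forall eps, 0 < eps <= 1 -> b (nu eps) <= C * eps ^- 1 &
      nu eps @[eps --> 0^'+] --> \oo].
Proof.
pose B n : R := 1 + \sum_(k < n.+1) (`|b k| + 1).
have Bn n : n%:R <= B n.
  rewrite /B big_split/= sumr_const card_ord -[n%:R]add0r.
  rewrite addrCA addrA lerD//; last by rewrite ler_nat.
  by rewrite addr_ge0// sumr_ge0.
have bB n : b n <= B n.
  have s0 : 0 <= \sum_(k < n) (`|b k| + 1).
    by rewrite sumr_ge0// => k _; rewrite addr_ge0.
  rewrite /B big_ord_recr/=; move: (ler_norm (b n)) s0; lra.
have B0 n : 0 < B n by rewrite ltr_pwDl// sumr_ge0// => i _; rewrite addr_ge0.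
have Bnd : nondecreasing_seq B.
  apply/nondecreasing_seqP => n.
  have -> : B n.+1 = B n + (`|b n.+1| + 1) by rewrite /B big_ord_recr addrA.
  by rewrite lerDl addr_ge0.
have best (eps : R) : exists n, (0 < eps <= 1 -> B n <= B 0%N * eps ^- 1) /\
    (0 < eps <= 1 -> forall m, B m <= B 0%N * eps ^- 1 -> (m <= n)%N).
  have [/andP[e0 e1]|ne] := boolP (0 < eps <= 1); last first.
    by exists 0%N.
  have ex0 : exists n, B n <= B 0%N * eps ^- 1.
    exists 0%N; rewrite expr1; apply: ler_peMr; first exact: ltW.
    by rewrite invf_ge1.
  have ub m : B m <= B 0%N * eps ^- 1 -> (m <= Num.bound (B 0%N * eps ^- 1))%N.
    move=> h; rewrite -(@ler_nat R); apply: (le_trans (Bn m)); apply: (le_trans h).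
    by apply/ltW; apply: archi_boundP; rewrite mulr_ge0 ?ltW// ?expr1 ?invr_gt0.
  by case: (ex_maxnP ex0 ub) => n Bn' nmax; exists n; split => // _ m; exact: nmax.
exists (B 0%N), (fun eps => projT1 (cid (best eps))); split => //.
  move=> eps eps01; case: (projT2 (cid (best eps))) => /(_ eps01) h _.
  exact: le_trans (bB _) h.
apply/cvgnyPge => n; near=> eps.
have e01 : 0 < eps <= 1.
  by apply/andP; split; near: eps; [exact: nbhs_right_gt|exact: nbhs_right_le].
case: (projT2 (cid (best eps))) => _ /(_ e01); apply.
have eB : eps <= B 0%N / B n.
  by near: eps; apply: nbhs_right_le; rewrite divr_gt0.
have e0 : 0 < eps by case/andP: e01.
by rewrite expr1 ler_pdivlMr// -ler_pdivlMl// mulrC.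
Unshelve. all: by end_near. Qed.

End Slowdown.

Section Nets.
Context {R : realType}.

Lemma reindexed_regularisation (X : set R) (p : nat -> R -> R) (nu : R -> nat)
    L : (forall n, smooth (p n)) ->
  (forall phi, test_function X phi -> distr_of X (p n) phi @[n --> \oo] --> L phi) ->
  nu eps @[eps --> 0^'+] --> \oo ->
  regularisation X (fun eps => p (nu eps)) L.
Proof.
move=> sp pL nuoo; split.
  move=> eps _; exists setT, (p (nu eps)); split => //; first exact: openT.
  by move=> n x _; exact: sp.
move=> phi tphi; apply: (@cvg_comp _ _ _ nu (fun n => distr_of X (p n) phi)).
  exact: nuoo.
exact: pL.
Qed.

End Nets.

Theorem theorem3p5 (R : realType) (T : R) (hT : 0 < T)
    (q : (R -> R) -> R) (hq : distribution_on `]0, 1[ q)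
    (hq0 : nonneg_distribution `]0, 1[ q)
    (u0 : (R -> R) -> R[i]) (hu0 : cdistribution_on `]0, 1[ u0)
    (a : (R -> R) -> R) (ha : distribution_on `[0, T] a)
    (ha0 : exists a0 : R, 0 < a0 /\
       nonneg_distribution `[0, T]
         (fun phi => a phi - distr_of `[0, T] (fun=> a0) phi)) :
  exists u : R -> R -> R -> R[i], very_weak_solution T a q u0 u.
Proof.
have cone : continuous (fun _ : R => 1 : R) by move=> x; exact: cvg_cst.
have csin : continuous (fun x : R => sin (pi * x)).
  exact: (smooth_continuous (n := 0) (smooth_sin (w := pi))).
have sin0' (x : R) : 0 <= x <= 1 -> 0 <= sin (pi * x).
  move=> /andP[x0 x1]; apply: sin_ge0_pi.
  by rewrite mulr_ge0 ?pi_ge0//= ler_piMr ?pi_ge0.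
have sinp (x : R) : 0 < x < 1 -> 0 < sin (pi * x).
  move=> /andP[x0 x1]; apply: sin_gt0_pi.
  by rewrite mulr_gt0 ?pi_gt0//= gtr_pMr ?pi_gt0.
have [pq [pqc pqL]] := distribution_trig_cvg ltr01 (or_introl erefl) hq cone
  (fun _ _ => ler01) (fun _ _ => ltr01).
have [pa [pac paL]] := distribution_trig_cvg hT (or_intror erefl) ha cone
  (fun _ _ => ler01) (fun _ _ => ltr01).
have [pf [pfc pfL]] := distribution_trig_cvg ltr01 (or_introl erefl) hu0.1 csin
  sin0' sinp.
have [pg [pgc pgL]] := distribution_trig_cvg ltr01 (or_introl erefl) hu0.2 csin
  sin0' sinp.
pose f n x := sin (pi * x) * pf n x; pose g n x := sin (pi * x) * pg n x.
have sf n : smooth (f n) by apply: sin_sum_smooth; exact: sin_cos_sum.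
have sg n : smooth (g n) by apply: sin_sum_smooth; exact: sin_cos_sum.
have sq n := cos_sum_smooth (pqc n).
have sa n := cos_sum_smooth (pac n).
have sol n : exists s : (R -> R -> R[i]) * (R -> R -> R[i]) * R,
    schrodinger_solution T (pa n) (pq n) (fun x => (f n x +i* g n x)%C) s.1.1 s.1.2 /\
    forall t, 0 <= t <= T ->
      (L2_norm (s.1.1 t) <= s.2%:E)%E /\ (L2_norm (s.1.2 t) <= s.2%:E)%E.
  have [u [ut [C HC]]] := regular_solution hT (sa n) (pqc n)
    (sin_cos_sum (pfc n)) (sin_cos_sum (pgc n)).
  by exists (u, ut, C).
have bounds (n : nat) : exists B : R, [/\ (Linfty_norm `]0%R, 1%R[%classic (pq n) <= B%:E)%E,
    (Linfty_norm `[0%R, T]%classic (pa n) <= B%:E)%E,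
    (L2_norm (fun x => (f n x +i* g n x)%C) <= B%:E)%E &
    (L2_norm (cderive2 (fun x => (f n x +i* g n x)%C)) <= B%:E)%E].
  have [Bq Bq0 hBq] := continuous_bounded_itv 0 1 (smooth_continuous (n := 0) (sq n)).
  have [Ba Ba0 hBa] := continuous_bounded_itv 0 T (smooth_continuous (n := 0) (sa n)).
  have [B1 B10 hB1] := continuous_bounded_itv 0 1 (smooth_continuous (n := 0) (sf n)).
  have [B2 B20 hB2] := continuous_bounded_itv 0 1 (smooth_continuous (n := 0) (sg n)).
  have [B3 B30 hB3] := continuous_bounded_itv 0 1 (smooth_continuous (n := 2) (sf n)).
  have [B4 B40 hB4] := continuous_bounded_itv 0 1 (smooth_continuous (n := 2) (sg n)).
  pose B := 2 * (Bq + Ba + B1 + B2 + B3 + B4).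
  have I01 (x : R) : (`]0, 1[%classic : set R) x -> 0 <= x <= 1.
    by rewrite /= in_itv/= => /andP[? ?]; rewrite !ltW.
  exists B; split.
  - apply: (@le_trans _ _ Bq%:E); last by rewrite lee_fin /B; lra.
    by apply: Linfty_norm_le => // x /I01; exact: hBq.
  - apply: (@le_trans _ _ Ba%:E); last by rewrite lee_fin /B; lra.
    by apply: Linfty_norm_le => // x /=; rewrite in_itv; exact: hBa.
  - apply: (@le_trans _ _ (2 * (B1 + B2))%:E); last by rewrite lee_fin /B; lra.
    have h1 (x : R) : (`]0, 1[%classic : set R) x -> `|f n x| <= B1 + B2.
      by move=> /I01 /hB1 h; apply: (le_trans h); lra.
    have h2 (x : R) : (`]0, 1[%classic : set R) x -> `|g n x| <= B1 + B2.
      by move=> /I01 /hB2 h; apply: (le_trans h); lra.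
    by have [] := continuous_in_L2 (smooth_continuous (n := 0) (sf n))
      (smooth_continuous (n := 0) (sg n)) h1 h2.
  - apply: (@le_trans _ _ (2 * (B3 + B4))%:E); last by rewrite lee_fin /B; lra.
    have h3 (x : R) : (`]0, 1[%classic : set R) x -> `|derive1n 2 (f n) x| <= B3 + B4.
      by move=> /I01 /hB3 h; apply: (le_trans h); lra.
    have h4 (x : R) : (`]0, 1[%classic : set R) x -> `|derive1n 2 (g n) x| <= B3 + B4.
      by move=> /I01 /hB4 h; apply: (le_trans h); lra.
    by have [] := continuous_in_L2 (smooth_continuous (n := 2) (sf n))
      (smooth_continuous (n := 2) (sg n)) h3 h4.
pose s n := projT1 (cid (sol n)); pose B n := projT1 (cid (bounds n)).
have [C [nu [C0 nuC nuoo]]] := slow_reindexing (fun n => Num.max (s n).2 (B n)).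
have moderate (x : \bar R) eps : 0 < eps <= 1 -> (x <= (B (nu eps))%:E)%E \/
    (x <= (s (nu eps)).2%:E)%E -> (x <= (C * eps ^- 1)%:E)%E.
  move=> /nuC h [] xB; apply: (le_trans xB); rewrite lee_fin; apply: le_trans h;
    by rewrite le_max lexx ?orbT.
exists (fun eps => (s (nu eps)).1.1), (fun eps => pq (nu eps)),
  (fun eps => pa (nu eps)),
  (fun eps x => (f (nu eps) x +i* g (nu eps) x)%C), (fun eps => (s (nu eps)).1.2).
have one_mul (p : nat -> R -> R) n : (fun x => 1 * p n x) = p n.
  by apply/funext => x; rewrite mul1r.
split.
- split.
    apply: reindexed_regularisation => // phi tphi.
    by have := pqL phi tphi; under eq_fun do rewrite one_mul.
  exists 1%N, C; split => // eps eps01; apply: moderate => //; left.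
  by have [] := projT2 (cid (bounds (nu eps))).
- split.
    apply: reindexed_regularisation => // phi tphi.
    by have := paL phi tphi; under eq_fun do rewrite one_mul.
  exists 1%N, C; split => // eps eps01; apply: moderate => //; left.
  by have [] := projT2 (cid (bounds (nu eps))).
- split.
    split; first exact: (reindexed_regularisation sf pfL nuoo).
    exact: (reindexed_regularisation sg pgL nuoo).
  exists 1%N, C; split => // eps eps01.
  by split; apply: moderate => //; left; have [] := projT2 (cid (bounds (nu eps))).
- by move=> eps eps01; have [] := projT2 (cid (sol (nu eps))).
- split; exists 1%N, C; split => // eps eps01 t tT; apply: moderate => //; right;
    by have [_ /(_ t tT)[]] := projT2 (cid (sol (nu eps))).
Qed.
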